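(* Let $c\in\mathbb{C}$ and let $V$ be a simple $\mathcal{B}$-module on which $C$ acts as the scalar $c$. Suppose there exists $r\in\mathbb{Z}$ with $r\geq 2$ such that (1) the action of $L_r$ on $V$ is injective; (2) $L_mV=0$ for all $m\in\mathbb{Z}$ with $m>r$, and $G_rV=0$. Then the induced $\mathcal{R}$-module $\mathrm{Ind}_{\mathcal{B},c}(V)=\mathcal{U}(\mathcal{R})\otimes_{\mathcal{U}(\mathcal{B})}V$ is simple.
   Context: The $N=1$ Ramond algebra is the complex Lie superalgebra $\mathcal{R}=\bigoplus_{m\in\mathbb{Z}}\mathbb{C}L_m\oplus\bigoplus_{m\in\mathbb{Z}}\mathbb{C}G_m\oplus\mathbb{C}C$, with even part $\mathrm{span}\{L_m,C\mid m\in\mathbb{Z}\}$ and odd part $\mathrm{span}\{G_m\mid m\in\mathbb{Z}\}$, and super-brackets (for $m,n\in\mathbb{Z}$) $$[L_m,L_n]=(n-m)L_{m+n}+\tfrac{n^3-n}{12}\delta_{m+n,0}C,\quad [G_m,G_n]=-2L_{m+n}+\tfrac{4m^2-1}{12}\delta_{m+n,0}C,\quad [L_m,G_n]=(n-\tfrac{m}{2})G_{m+n},\quad [\mathcal{R},C]=0.$$ $\mathcal{B}$ is the subalgebra $\mathcal{B}=\mathrm{span}\{L_m,G_m\mid m\geq 1\}\oplus\mathbb{C}L_0\oplus\mathbb{C}C$ (it does not contain $G_0$). $\mathcal{U}(\cdot)$ denotes the universal enveloping algebra. All vector spaces are over $\mathbb{C}$; all modules (and submodules) over Lie superalgebras are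 $\mathbb{Z}_2$-graded, with $x(yv)-(-1)^{|x||y|}y(xv)=[x,y]v$ for homogeneous $x,y$; simple modules are assumed non-trivial. For a simple module over $\mathcal{R}$ or over a subalgebra containing $C$, the element $C$ acts as a scalar, denoted $c$.
   Formalization: The central term of [L_m,L_n] is taken as (m^3-m)/12 instead of the printed (n^3-n)/12, because the printed brackets violate the super Jacobi identity (e.g. on L_2, G_{-1}, G_{-1}) and so define no Lie superalgebra. *)

(* Defs.v *)
From HB Require Import structures.
From mathcomp Require Import all_boot all_order all_algebra.
From mathcomp Require Import finmap.
From mathcomp Require Import ring.
From mathcomp Require Import boolp reals.
From mathcomp Require Import complex.
From mathcomp.multinomials Require Import monalg.

Set Implicit Arguments.
Unset Strict Implicit.
Unset Printing Implicit Defensive.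

Import Order.TTheory GRing.Theory Num.Theory.
Local Open Scope ring_scope.
Local Open Scope quotient_scope.

Section Grading.
Variables (K : numFieldType) (V : lmodType K).

(* V = V_0 (+) V_1; [hom false] is the even part and [hom true] the odd part. *)
Record grading := Grading {
  hom : bool -> V -> Prop;
  hom0 : forall b, hom b 0;
  hom_lin : forall b (a : K) x y, hom b x -> hom b y -> hom b (a *: x + y);
  hom_decomp : forall x, exists x0 x1,
    [/\ hom false x0, hom true x1 & x = x0 + x1];
  hom_disj : forall x, hom false x -> hom true x -> x = 0 }.

Variable E : grading.

Lemma homD b x y : hom E b x -> hom E b y -> hom E b (x + y).
Proof. by move=> hx hy; rewrite -[x]scale1r; apply: hom_lin. Qed.

Lemma homZ b a x : hom E b x -> hom E b (a *: x).
Proof. by move=> hx; rewrite -[_ *: _]addr0; apply: hom_lin => //; exact: hom0. Qed.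

Lemma homN b x : hom E b x -> hom E b (- x).
Proof. by move=> hx; rewrite -scaleN1r; apply: homZ. Qed.

Lemma hom_uniq x0 x1 y0 y1 : hom E false x0 -> hom E true x1 ->
  hom E false y0 -> hom E true y1 -> x0 + x1 = y0 + y1 -> x0 = y0 /\ x1 = y1.
Proof.
move=> h0 h1 k0 k1 e.
have d : x0 - y0 = y1 - x1.
  by apply/eqP; rewrite subr_eq addrAC eq_sym subr_eq addrC -e addrC.
have z : x0 - y0 = 0.
  apply: (hom_disj (g := E)); first by apply: homD => //; apply: homN.
  by rewrite d; apply: homD => //; apply: homN.
split; first by apply/eqP; rewrite -subr_eq0 z.
by apply/eqP; rewrite eq_sym -subr_eq0 -d z.
Qed.

(* The parity involution, x0 + x1 |-> x0 - x1. *)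
Definition parity_inv (x : V) : V :=
  let d := cid (hom_decomp E x) in projT1 d - projT1 (cid (projT2 d)).

Lemma parity_invE x0 x1 : hom E false x0 -> hom E true x1 ->
  parity_inv (x0 + x1) = x0 - x1.
Proof.
move=> h0 h1; rewrite /parity_inv.
case: cid => y0 hy0 /=; case: cid => y1 [k0 k1 e] /=.
by have [-> ->] := hom_uniq h0 h1 k0 k1 e.
Qed.

Lemma parity_inv_lin (a : K) x y :
  parity_inv (a *: x + y) = a *: parity_inv x + parity_inv y.
Proof.
have [x0 [x1 [hx0 hx1 ->]]] := hom_decomp E x.
have [y0 [y1 [hy0 hy1 ->]]] := hom_decomp E y.
rewrite scalerDr addrACA !parity_invE //; try exact: hom_lin.
by rewrite scalerBr opprD addrACA.
Qed.

Lemma parity_inv_hom b x : hom E b x -> parity_inv x = (-1) ^+ b *: x.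
Proof.
case: b => hx.
  by rewrite -[x in LHS]add0r parity_invE ?sub0r ?expr1 ?scaleN1r //; exact: hom0.
by rewrite -[x in LHS]addr0 parity_invE ?subr0 ?expr0 ?scale1r //; exact: hom0.
Qed.

End Grading.

Section LieSuperalgebra.
Variable K : numFieldType.

Record lieSuperalgebra := LieSuperalgebra {
  lsa_sort :> lmodType K;
  lsa_grading : grading lsa_sort;
  bracket : lsa_sort -> lsa_sort -> lsa_sort;
  bracket_linl : forall (a : K) x y z,
    bracket (a *: x + y) z = a *: bracket x z + bracket y z;
  bracket_linr : forall (a : K) x y z,
    bracket z (a *: x + y) = a *: bracket z x + bracket z y;
  bracket_hom : forall b c x y, hom lsa_grading b x -> hom lsa_grading c y ->
    hom lsa_grading (b (+) c) (bracket x y);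
  bracket_skew : forall b c x y, hom lsa_grading b x -> hom lsa_grading c y ->
    bracket x y = - ((-1) ^+ (b && c) *: bracket y x);
  bracket_jacobi : forall b c d x y z, hom lsa_grading b x ->
    hom lsa_grading c y -> hom lsa_grading d z ->
    bracket x (bracket y z) =
      bracket (bracket x y) z + (-1) ^+ (b && c) *: bracket y (bracket x z) }.

Record superModule (g : lieSuperalgebra) := SuperModule {
  smod_sort :> lmodType K;
  smod_grading : grading smod_sort;
  act : g -> smod_sort -> smod_sort;
  act_linl : forall (a : K) x y v, act (a *: x + y) v = a *: act x v + act y v;
  act_linr : forall (a : K) x v w, act x (a *: v + w) = a *: act x v + act x w;
  act_hom : forall b c x v, hom (lsa_grading g) b x -> hom smod_grading c v ->
    hom smod_grading (b (+) c) (act x v);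
  act_bracket : forall b c x y v,
    hom (lsa_grading g) b x -> hom (lsa_grading g) c y ->
    act x (act y v) - (-1) ^+ (b && c) *: act y (act x v) = act (bracket x y) v }.

Record graded_submodule (g : lieSuperalgebra) (M : superModule g)
    (W : M -> Prop) : Prop := GradedSubmodule {
  gsub0 : W 0;
  gsub_lin : forall (a : K) v w, W v -> W w -> W (a *: v + w);
  gsub_act : forall (x : g) v, W v -> W (act x v);
  gsub_graded : forall v, W v -> exists v0 v1,
    [/\ W v0 /\ W v1, hom (smod_grading M) false v0,
        hom (smod_grading M) true v1 & v = v0 + v1] }.

(* Non-triviality is asked of the action; in particular M is nonzero. *)
Definition simple_module (g : lieSuperalgebra) (M : superModule g) : Prop :=
  (exists (x : g) (v : M), act x v <> 0) /\
  forall W : M -> Prop, graded_submodule W ->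
    (forall v, W v -> v = 0) \/ (forall v, W v).

Record subalgebra (g : lieSuperalgebra) := Subalgebra {
  sub_mem : pred g;
  sub_mem0 : sub_mem 0;
  sub_mem_lin : forall (a : K) x y,
    sub_mem x -> sub_mem y -> sub_mem (a *: x + y);
  sub_mem_graded : forall x, sub_mem x -> exists x0 x1,
    [/\ sub_mem x0 && sub_mem x1, hom (lsa_grading g) false x0,
        hom (lsa_grading g) true x1 & x = x0 + x1];
  sub_mem_bracket : forall x y, sub_mem x -> sub_mem y ->
    sub_mem (bracket x y) }.

End LieSuperalgebra.

Section SubalgebraLie.
Variables (K : numFieldType) (g : lieSuperalgebra K) (S : subalgebra g).

Definition sub_pred : pred g := sub_mem S.

Lemma sub_pred_closed : subsemimod_closed sub_pred.
Proof.
split; first split; first exact: sub_mem0.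
  by move=> x y hx hy; rewrite -[x]scale1r; apply: sub_mem_lin.
by move=> a x hx; rewrite -[_ *: _]addr0; apply: sub_mem_lin => //; exact: sub_mem0.
Qed.

HB.instance Definition _ := GRing.isSubmodClosed.Build K g sub_pred sub_pred_closed.

Record sub_sort := SubElt { sub_val : g; _ : sub_pred sub_val }.

HB.instance Definition _ := [isSub for sub_val].
HB.instance Definition _ := [Choice of sub_sort by <:].
HB.instance Definition _ := [SubChoice_isSubLmodule of sub_sort by <:].

Lemma sub_val_inj : injective sub_val.
Proof. exact: (@val_inj _ _ sub_sort). Qed.
Lemma sub_val0 : sub_val 0 = 0.
Proof. exact: (raddf0 (val : sub_sort -> g)). Qed.
Lemma sub_valN x : sub_val (- x) = - sub_val x.
Proof. exact: (raddfN (val : sub_sort -> g)). Qed.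
Lemma sub_valD x y : sub_val (x + y) = sub_val x + sub_val y.
Proof. exact: (raddfD (val : sub_sort -> g)). Qed.
Lemma sub_valZ (a : K) x : sub_val (a *: x) = a *: sub_val x.
Proof. exact: (GRing.valZ (s := sub_sort)). Qed.

Lemma sub_val_lin (a : K) x y :
  sub_val (a *: x + y) = a *: sub_val x + sub_val y.
Proof. by rewrite sub_valD sub_valZ. Qed.

Definition sub_hom b (x : sub_sort) := hom (lsa_grading g) b (sub_val x).

Lemma sub_hom0 b : sub_hom b 0.
Proof. by rewrite /sub_hom sub_val0; exact: hom0. Qed.
Lemma sub_hom_lin b (a : K) x y :
  sub_hom b x -> sub_hom b y -> sub_hom b (a *: x + y).
Proof. by rewrite /sub_hom sub_val_lin; exact: hom_lin. Qed.
Lemma sub_hom_decomp x : exists x0 x1,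
  [/\ sub_hom false x0, sub_hom true x1 & x = x0 + x1].
Proof.
have [x0 [x1 [/andP[m0 m1] h0 h1 e]]] := sub_mem_graded (valP x).
exists (SubElt m0), (SubElt m1); split => //.
by apply: sub_val_inj; exact: e.
Qed.
Lemma sub_hom_disj x : sub_hom false x -> sub_hom true x -> x = 0.
Proof.
by move=> h0 h1; apply: sub_val_inj; rewrite sub_val0; exact: hom_disj h0 h1.
Qed.
Definition sub_grading : grading sub_sort :=
  Grading sub_hom0 sub_hom_lin sub_hom_decomp sub_hom_disj.

Definition sub_bracket (x y : sub_sort) : sub_sort :=
  SubElt (sub_mem_bracket (valP x) (valP y)).

Lemma sub_val_bracket x y :
  sub_val (sub_bracket x y) = bracket (sub_val x) (sub_val y).
Proof. by []. Qed.
Lemma sub_bracket_linl (a : K) x y z :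
  sub_bracket (a *: x + y) z = a *: sub_bracket x z + sub_bracket y z.
Proof. by apply: sub_val_inj; rewrite sub_val_lin !sub_val_bracket sub_val_lin bracket_linl. Qed.
Lemma sub_bracket_linr (a : K) x y z :
  sub_bracket z (a *: x + y) = a *: sub_bracket z x + sub_bracket z y.
Proof. by apply: sub_val_inj; rewrite sub_val_lin !sub_val_bracket sub_val_lin bracket_linr. Qed.
Lemma sub_bracket_hom b c x y : sub_hom b x -> sub_hom c y ->
  sub_hom (b (+) c) (sub_bracket x y).
Proof. exact: bracket_hom. Qed.
Lemma sub_bracket_skew b c x y : sub_hom b x -> sub_hom c y ->
  sub_bracket x y = - ((-1) ^+ (b && c) *: sub_bracket y x).
Proof.
move=> hx hy; apply: sub_val_inj; rewrite sub_valN sub_valZ.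
exact: bracket_skew.
Qed.
Lemma sub_bracket_jacobi b c d x y z :
  sub_hom b x -> sub_hom c y -> sub_hom d z ->
  sub_bracket x (sub_bracket y z) = sub_bracket (sub_bracket x y) z +
    (-1) ^+ (b && c) *: sub_bracket y (sub_bracket x z).
Proof.
move=> hx hy hz; apply: sub_val_inj; rewrite sub_valD sub_valZ.
exact: bracket_jacobi hz.
Qed.

Definition subalg_lie : lieSuperalgebra K :=
  @LieSuperalgebra K sub_sort sub_grading sub_bracket sub_bracket_linl
    sub_bracket_linr sub_bracket_hom sub_bracket_skew sub_bracket_jacobi.

End SubalgebraLie.

Coercion subalg_lie : subalgebra >-> lieSuperalgebra.

Section Envelope.
Variables (K : numFieldType) (g : lieSuperalgebra K).

(* U(g) is presented as the unital associative K-algebra with generators the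
   elements of g, subject to the linear relations of g (which give the tensor
   algebra) and to xy - (-1)^(|x||y|) yx = [x, y] for homogeneous x, y.
   [uterm] is the set of algebra words in these generators and [ueq] is the
   congruence generated by the algebra axioms and the relations. *)
Inductive uterm :=
  | UVar of g
  | UConst of K
  | UAdd of uterm & uterm
  | UMul of uterm & uterm.

Inductive ueq : uterm -> uterm -> Prop :=
  | ueq_refl s : ueq s s
  | ueq_sym s t : ueq s t -> ueq t s
  | ueq_trans s t u : ueq s t -> ueq t u -> ueq s u
  | ueq_add s s' t t' : ueq s s' -> ueq t t' -> ueq (UAdd s t) (UAdd s' t')
  | ueq_mul s s' t t' : ueq s s' -> ueq t t' -> ueq (UMul s t) (UMul s' t')
  | ueq_addA s t u : ueq (UAdd s (UAdd t u)) (UAdd (UAdd s t) u)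
  | ueq_addC s t : ueq (UAdd s t) (UAdd t s)
  | ueq_add0 s : ueq (UAdd (UConst 0) s) s
  | ueq_addN s : ueq (UAdd (UMul (UConst (-1)) s) s) (UConst 0)
  | ueq_mulA s t u : ueq (UMul s (UMul t u)) (UMul (UMul s t) u)
  | ueq_mul1 s : ueq (UMul (UConst 1) s) s
  | ueq_mulDl s t u : ueq (UMul (UAdd s t) u) (UAdd (UMul s u) (UMul t u))
  | ueq_mulDr s t u : ueq (UMul s (UAdd t u)) (UAdd (UMul s t) (UMul s u))
  | ueq_constD a b : ueq (UConst (a + b)) (UAdd (UConst a) (UConst b))
  | ueq_constM a b : ueq (UConst (a * b)) (UMul (UConst a) (UConst b))
  | ueq_constC a s : ueq (UMul (UConst a) s) (UMul s (UConst a))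
  | ueq_lin a x y :
      ueq (UVar (a *: x + y)) (UAdd (UMul (UConst a) (UVar x)) (UVar y))
  | ueq_bracket b c x y : hom (lsa_grading g) b x -> hom (lsa_grading g) c y ->
      ueq (UMul (UVar x) (UVar y))
          (UAdd (UMul (UConst ((-1) ^+ (b && c))) (UMul (UVar y) (UVar x)))
                (UVar (bracket x y))).

HB.instance Definition _ := gen_eqMixin uterm.
HB.instance Definition _ := gen_choiceMixin uterm.

Definition ueqb : rel uterm := fun s t => `[< ueq s t >].

Lemma ueqb_equiv : equiv_class_of ueqb.
Proof.
split.
- by move=> s; apply/asboolP; exact: ueq_refl.
- by move=> s t; apply/asboolP/asboolP; exact: ueq_sym.
- by move=> t s u /asboolP h /asboolP k; apply/asboolP; exact: ueq_trans h k.
Qed.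
Canonical ueqb_rel := EquivRelPack ueqb_equiv.

Definition envalg := {eq_quot ueqb}.
HB.instance Definition _ := Choice.on envalg.
HB.instance Definition _ := Quotient.on envalg.

Lemma envalgP s t : ueq s t <-> \pi_envalg s = \pi_envalg t.
Proof.
by split => [h|/eqmodP /asboolP //]; apply/eqmodP/asboolP.
Qed.

Lemma ueq_repr s : ueq (repr (\pi_envalg s)) s.
Proof. by apply/envalgP; rewrite reprK. Qed.

Definition env_const (a : K) : envalg := \pi_envalg (UConst a).
Definition env_add (u v : envalg) : envalg := \pi_envalg (UAdd (repr u) (repr v)).
Definition env_mul (u v : envalg) : envalg := \pi_envalg (UMul (repr u) (repr v)).
Definition env_opp (u : envalg) : envalg := env_mul (env_const (-1)) u.

Lemma env_addE s t : env_add (\pi_envalg s) (\pi_envalg t) = \pi_envalg (UAdd s t).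
Proof. by apply/envalgP; apply: ueq_add; exact: ueq_repr. Qed.

Lemma env_mulE s t : env_mul (\pi_envalg s) (\pi_envalg t) = \pi_envalg (UMul s t).
Proof. by apply/envalgP; apply: ueq_mul; exact: ueq_repr. Qed.

Lemma env_addA : associative env_add.
Proof.
elim/quotW => s; elim/quotW => t; elim/quotW => u.
by rewrite (env_addE t u) (env_addE s t) !env_addE; apply/envalgP; exact: ueq_addA.
Qed.
Lemma env_addC : commutative env_add.
Proof.
elim/quotW => s; elim/quotW => t.
by rewrite !env_addE; apply/envalgP; exact: ueq_addC.
Qed.
Lemma env_add0 : left_id (env_const 0) env_add.
Proof. by elim/quotW => s; rewrite env_addE; apply/envalgP; exact: ueq_add0. Qed.
Lemma env_addN : left_inverse (env_const 0) env_opp env_add.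
Proof.
by elim/quotW => s; rewrite /env_opp /env_const (env_mulE _ s) env_addE; apply/envalgP; exact: ueq_addN.
Qed.
HB.instance Definition _ :=
  GRing.isZmodule.Build envalg env_addA env_addC env_add0 env_addN.

Lemma env_mulA : associative env_mul.
Proof.
elim/quotW => s; elim/quotW => t; elim/quotW => u.
by rewrite (env_mulE t u) (env_mulE s t) !env_mulE; apply/envalgP; exact: ueq_mulA.
Qed.
Lemma env_mul1 : left_id (env_const 1) env_mul.
Proof. by elim/quotW => s; rewrite env_mulE; apply/envalgP; exact: ueq_mul1. Qed.
Lemma env_constC a u : env_mul (env_const a) u = env_mul u (env_const a).
Proof. by elim/quotW: u => s; rewrite !env_mulE; apply/envalgP; exact: ueq_constC. Qed.
Lemma env_mulr1 : right_id (env_const 1) env_mul.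
Proof. by move=> u; rewrite -env_constC env_mul1. Qed.
Lemma env_mulDl : left_distributive env_mul +%R.
Proof.
elim/quotW => s; elim/quotW => t; elim/quotW => u; rewrite /+%R /=.
rewrite (env_addE s t) (env_mulE s u) (env_mulE t u) env_addE env_mulE.
by apply/envalgP; exact: ueq_mulDl.
Qed.
Lemma env_mulDr : right_distributive env_mul +%R.
Proof.
elim/quotW => s; elim/quotW => t; elim/quotW => u; rewrite /+%R /=.
rewrite (env_addE t u) (env_mulE s t) (env_mulE s u) env_addE env_mulE.
by apply/envalgP; exact: ueq_mulDr.
Qed.

(* The augmentation, used only for 1 != 0. *)
Fixpoint uaug (t : uterm) : K :=
  match t with
  | UVar _ => 0
  | UConst a => a
  | UAdd s t => uaug s + uaug t
  | UMul s t => uaug s * uaug t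
  end.

Lemma uaug_eq s t : ueq s t -> uaug s = uaug t.
Proof.
elim=> //= *; rewrite ?(mulN1r, mul0r, mulr0, addr0) //.
all: by [congruence | ring].
Qed.

Lemma env_oner_neq0 : env_const 1 != 0.
Proof.
apply/eqP => /envalgP /uaug_eq /= /eqP; rewrite oner_eq0; exact/negP.
Qed.

HB.instance Definition _ := GRing.Zmodule_isNzRing.Build envalg
  env_mulA env_mul1 env_mulr1 env_mulDl env_mulDr env_oner_neq0.

Definition env_scale (a : K) (u : envalg) : envalg := env_const a * u.

Lemma env_scaleA a b u : env_scale a (env_scale b u) = env_scale (a * b) u.
Proof.
rewrite /env_scale mulrA; congr (_ * _); rewrite /env_const /*%R /= env_mulE.
by apply/envalgP/ueq_sym; exact: ueq_constM.
Qed.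
Lemma env_scale1 : left_id 1 env_scale.
Proof. by move=> u; exact: mul1r. Qed.
Lemma env_scaleDr : right_distributive env_scale +%R.
Proof. by move=> a u v; exact: mulrDr. Qed.
Lemma env_scaleDl u : {morph env_scale^~ u : a b / a + b}.
Proof.
move=> a b; rewrite /env_scale -mulrDl; congr (_ * _).
by rewrite /env_const /+%R /= env_addE; apply/envalgP; exact: ueq_constD.
Qed.
HB.instance Definition _ := GRing.Zmodule_isLmodule.Build K envalg
  env_scaleA env_scale1 env_scaleDr env_scaleDl.

Lemma env_scaleAl (a : K) (u v : envalg) : a *: (u * v) = (a *: u) * v.
Proof. exact: mulrA. Qed.
HB.instance Definition _ := GRing.Lmodule_isLalgebra.Build K envalg env_scaleAl.

Lemma env_scaleAr (a : K) (u v : envalg) : a *: (u * v) = u * (a *: v).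
Proof.
rewrite /GRing.scale /= /env_scale mulrA [u * (_ * _)]mulrA; congr (_ * _).
exact: env_constC.
Qed.
HB.instance Definition _ := GRing.Lalgebra_isAlgebra.Build K envalg env_scaleAr.

Definition env_var (x : g) : envalg := \pi_envalg (UVar x).

Lemma env_constE a : env_const a = a%:A.
Proof. by symmetry; exact: mulr1. Qed.

Lemma pi_UAdd s t : \pi_envalg (UAdd s t) = \pi_envalg s + \pi_envalg t.
Proof. by rewrite -env_addE. Qed.
Lemma pi_UMul s t : \pi_envalg (UMul s t) = \pi_envalg s * \pi_envalg t.
Proof. by rewrite -env_mulE. Qed.
Lemma pi_UConst a : \pi_envalg (UConst a) = a%:A.
Proof. exact: env_constE. Qed.

Lemma env_var_lin (a : K) x y : env_var (a *: x + y) = a *: env_var x + env_var y.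
Proof.
have /envalgP := ueq_lin a x y.
by rewrite pi_UAdd pi_UMul pi_UConst -scalerAl mul1r.
Qed.

Lemma env_var_bracket b c x y :
  hom (lsa_grading g) b x -> hom (lsa_grading g) c y ->
  env_var x * env_var y - (-1) ^+ (b && c) *: (env_var y * env_var x)
    = env_var (bracket x y).
Proof.
move=> hx hy; have /envalgP := ueq_bracket hx hy.
rewrite pi_UAdd !pi_UMul pi_UConst -scalerAl mul1r => ->.
by rewrite addrC addKr.
Qed.

Lemma env_ind (P : envalg -> Prop) :
  (forall x, P (env_var x)) -> (forall a : K, P a%:A) ->
  (forall u v, P u -> P v -> P (u + v)) ->
  (forall u v, P u -> P v -> P (u * v)) -> forall u, P u.
Proof.
move=> hv hc ha hm; elim/quotW; elim=> [x|a|s hs t ht|s hs t ht].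
- exact: hv.
- by rewrite pi_UConst.
- by rewrite pi_UAdd; exact: ha.
- by rewrite pi_UMul; exact: hm.
Qed.

(* The grading of U(g) induced by that of g. *)
Inductive env_hom : bool -> envalg -> Prop :=
  | env_hom0 b : env_hom b 0
  | env_homA a : env_hom false a%:A
  | env_homX b x : hom (lsa_grading g) b x -> env_hom b (env_var x)
  | env_homD b u v : env_hom b u -> env_hom b v -> env_hom b (u + v)
  | env_homM b c u v : env_hom b u -> env_hom c v -> env_hom (b (+) c) (u * v).

Section Universal.
Variables (A : algType K) (f : g -> A).
Hypothesis f_lin : forall (a : K) x y, f (a *: x + y) = a *: f x + f y.
Hypothesis f_bracket : forall b c x y,
  hom (lsa_grading g) b x -> hom (lsa_grading g) c y ->
  f x * f y - (-1) ^+ (b && c) *: (f y * f x) = f (bracket x y).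

Fixpoint ueval (t : uterm) : A :=
  match t with
  | UVar x => f x
  | UConst a => a%:A
  | UAdd s t => ueval s + ueval t
  | UMul s t => ueval s * ueval t
  end.

Lemma ueval_eq s t : ueq s t -> ueval s = ueval t.
Proof.
elim=> //=.
- by move=> > _ -> _ ->.
- by move=> > _ -> _ ->.
- by move=> > _ -> _ ->.
- by move=> *; rewrite addrA.
- by move=> *; rewrite addrC.
- by move=> *; rewrite scale0r add0r.
- by move=> *; rewrite scaleN1r mulN1r addNr scale0r.
- by move=> *; rewrite mulrA.
- by move=> *; rewrite scale1r mul1r.
- by move=> *; rewrite mulrDl.
- by move=> *; rewrite mulrDr.
- by move=> *; rewrite scalerDl.
- by move=> *; rewrite -scalerAl mul1r scalerA.
- by move=> *; rewrite -scalerAl -scalerAr mul1r mulr1.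
- by move=> *; rewrite f_lin -scalerAl mul1r.
- by move=> > hx hy; rewrite -(f_bracket hx hy) -scalerAl mul1r addrC subrK.
Qed.

Definition env_lift (u : envalg) : A := ueval (repr u).

Lemma env_lift_pi s : env_lift (\pi_envalg s) = ueval s.
Proof. by apply: ueval_eq; exact: ueq_repr. Qed.

Lemma env_lift_var x : env_lift (env_var x) = f x.
Proof. by rewrite env_lift_pi. Qed.

Lemma env_liftD u v : env_lift (u + v) = env_lift u + env_lift v.
Proof. by elim/quotW: u => s; elim/quotW: v => t; rewrite -pi_UAdd !env_lift_pi. Qed.
Lemma env_liftM u v : env_lift (u * v) = env_lift u * env_lift v.
Proof. by elim/quotW: u => s; elim/quotW: v => t; rewrite -pi_UMul !env_lift_pi. Qed.
Lemma env_liftA (a : K) : env_lift a%:A = a%:A.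
Proof. by rewrite -pi_UConst env_lift_pi. Qed.

Lemma env_lift_zmod : zmod_morphism env_lift.
Proof.
move=> u v; have -> : - v = (-1)%:A * v by rewrite scaleN1r mulN1r.
by rewrite env_liftD env_liftM env_liftA scaleN1r mulN1r.
Qed.
Lemma env_lift_monoid : monoid_morphism env_lift.
Proof. by split; [rewrite -[1]scale1r env_liftA scale1r | exact: env_liftM]. Qed.

End Universal.

End Envelope.

(* B (x)_A N for a ring morphism A -> B and a left A-module N, as the abelian
   group generated by the pure tensors modulo biadditivity and
   (b a) (x) n = b (x) (a n). *)
Section ExtensionOfScalars.
Variables (A B : pzRingType) (phi : {rmorphism A -> B}) (N : lmodType A).

Inductive tterm :=
  | TPure of B & N
  | TZero
  | TOpp of tterm
  | TAdd of tterm & tterm.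

Inductive teq : tterm -> tterm -> Prop :=
  | teq_refl s : teq s s
  | teq_sym s t : teq s t -> teq t s
  | teq_trans s t u : teq s t -> teq t u -> teq s u
  | teq_opp s s' : teq s s' -> teq (TOpp s) (TOpp s')
  | teq_add s s' t t' : teq s s' -> teq t t' -> teq (TAdd s t) (TAdd s' t')
  | teq_addA s t u : teq (TAdd s (TAdd t u)) (TAdd (TAdd s t) u)
  | teq_addC s t : teq (TAdd s t) (TAdd t s)
  | teq_add0 s : teq (TAdd TZero s) s
  | teq_addN s : teq (TAdd (TOpp s) s) TZero
  | teq_pureDl b b' n : teq (TPure (b + b') n) (TAdd (TPure b n) (TPure b' n))
  | teq_pureDr b n n' : teq (TPure b (n + n')) (TAdd (TPure b n) (TPure b n'))
  | teq_bal b a n : teq (TPure (b * phi a) n) (TPure b (a *: n)).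

HB.instance Definition _ := gen_eqMixin tterm.
HB.instance Definition _ := gen_choiceMixin tterm.

Definition teqb : rel tterm := fun s t => `[< teq s t >].

Lemma teqb_equiv : equiv_class_of teqb.
Proof.
split.
- by move=> s; apply/asboolP; exact: teq_refl.
- by move=> s t; apply/asboolP/asboolP; exact: teq_sym.
- by move=> t s u /asboolP h /asboolP k; apply/asboolP; exact: teq_trans h k.
Qed.
Canonical teqb_rel := EquivRelPack teqb_equiv.

Definition ext_scalars := {eq_quot teqb}.
HB.instance Definition _ := Choice.on ext_scalars.
HB.instance Definition _ := Quotient.on ext_scalars.

Lemma ext_scalarsP s t : teq s t <-> \pi_ext_scalars s = \pi_ext_scalars t.
Proof.
by split => [h|/eqmodP /asboolP //]; apply/eqmodP/asboolP.
Qed.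

Lemma teq_repr s : teq (repr (\pi_ext_scalars s)) s.
Proof. by apply/ext_scalarsP; rewrite reprK. Qed.

Fixpoint tscale (b : B) (t : tterm) : tterm :=
  match t with
  | TPure b' n => TPure (b * b') n
  | TZero => TZero
  | TOpp t => TOpp (tscale b t)
  | TAdd s t => TAdd (tscale b s) (tscale b t)
  end.

Lemma tscale_eq b s t : teq s t -> teq (tscale b s) (tscale b t).
Proof.
elim=> //=; try by move=> *; constructor.
- by move=> s' t' u _ h _ k; exact: teq_trans h k.
- by move=> *; rewrite mulrDr; constructor.
- by move=> *; rewrite mulrA; constructor.
Qed.

Definition ext_zero : ext_scalars := \pi TZero.
Definition ext_opp (u : ext_scalars) : ext_scalars := \pi_ext_scalars (TOpp (repr u)).
Definition ext_add (u v : ext_scalars) : ext_scalars := \pi_ext_scalars (TAdd (repr u) (repr v)).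
Definition ext_scale b (u : ext_scalars) : ext_scalars := \pi_ext_scalars (tscale b (repr u)).

Lemma ext_oppE s : ext_opp (\pi_ext_scalars s) = \pi_ext_scalars (TOpp s).
Proof. by apply/ext_scalarsP; apply: teq_opp; exact: teq_repr. Qed.
Lemma ext_addE s t : ext_add (\pi_ext_scalars s) (\pi_ext_scalars t) = \pi_ext_scalars (TAdd s t).
Proof. by apply/ext_scalarsP; apply: teq_add; exact: teq_repr. Qed.
Lemma ext_scaleE b s : ext_scale b (\pi_ext_scalars s) = \pi_ext_scalars (tscale b s).
Proof. by apply/ext_scalarsP; apply: tscale_eq; exact: teq_repr. Qed.

Lemma ext_addA : associative ext_add.
Proof.
elim/quotW => s; elim/quotW => t; elim/quotW => u.
by rewrite (ext_addE t u) (ext_addE s t) !ext_addE; apply/ext_scalarsP; exact: teq_addA.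
Qed.
Lemma ext_addC : commutative ext_add.
Proof.
elim/quotW => s; elim/quotW => t.
by rewrite !ext_addE; apply/ext_scalarsP; exact: teq_addC.
Qed.
Lemma ext_add0 : left_id ext_zero ext_add.
Proof. by elim/quotW => s; rewrite ext_addE; apply/ext_scalarsP; exact: teq_add0. Qed.
Lemma ext_addN : left_inverse ext_zero ext_opp ext_add.
Proof.
by elim/quotW => s; rewrite (ext_oppE s) ext_addE; apply/ext_scalarsP; exact: teq_addN.
Qed.
HB.instance Definition _ :=
  GRing.isZmodule.Build ext_scalars ext_addA ext_addC ext_add0 ext_addN.

Lemma pi_TAdd s t : \pi_ext_scalars (TAdd s t) = \pi_ext_scalars s + \pi_ext_scalars t.
Proof. by rewrite -ext_addE. Qed.
Lemma pi_TOpp s : \pi_ext_scalars (TOpp s) = - \pi_ext_scalars s.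
Proof. by rewrite -ext_oppE. Qed.
Lemma pi_TZero : \pi_ext_scalars TZero = 0.
Proof. by []. Qed.

Definition tens (b : B) (n : N) : ext_scalars := \pi_ext_scalars (TPure b n).

Lemma tensDl b b' n : tens (b + b') n = tens b n + tens b' n.
Proof. by rewrite -pi_TAdd; apply/ext_scalarsP; exact: teq_pureDl. Qed.
Lemma tensDr b n n' : tens b (n + n') = tens b n + tens b n'.
Proof. by rewrite -pi_TAdd; apply/ext_scalarsP; exact: teq_pureDr. Qed.
Lemma tens_bal b a n : tens (b * phi a) n = tens b (a *: n).
Proof. by apply/ext_scalarsP; exact: teq_bal. Qed.

Lemma ext_ind (P : ext_scalars -> Prop) :
  (forall b n, P (tens b n)) -> P 0 -> (forall u, P u -> P (- u)) ->
  (forall u v, P u -> P v -> P (u + v)) -> forall u, P u.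
Proof.
move=> hp h0 hn ha; elim/quotW; elim=> [b n||s hs|s hs t ht].
- exact: hp.
- exact: h0.
- by rewrite pi_TOpp; exact: hn.
- by rewrite pi_TAdd; exact: ha.
Qed.

Lemma ext_scaleDr : right_distributive ext_scale +%R.
Proof.
move=> b; elim/quotW => s; elim/quotW => t.
by rewrite -pi_TAdd !ext_scaleE -pi_TAdd.
Qed.
Lemma ext_scaleN b u : ext_scale b (- u) = - ext_scale b u.
Proof. by elim/quotW: u => s; rewrite -pi_TOpp !ext_scaleE -pi_TOpp. Qed.
Lemma ext_scale0 b : ext_scale b 0 = 0.
Proof. by rewrite -pi_TZero ext_scaleE. Qed.
Lemma ext_scale_tens b b' n : ext_scale b (tens b' n) = tens (b * b') n.
Proof. by rewrite ext_scaleE. Qed.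

Lemma ext_scaleA a b u : ext_scale a (ext_scale b u) = ext_scale (a * b) u.
Proof.
elim/ext_ind: u => [c n||u h|u v h k].
- by rewrite !ext_scale_tens mulrA.
- by rewrite !ext_scale0.
- by rewrite !ext_scaleN h.
- by rewrite !ext_scaleDr h k.
Qed.
Lemma ext_scale1 : left_id 1 ext_scale.
Proof.
elim/ext_ind => [c n||u h|u v h k].
- by rewrite !ext_scale_tens mul1r.
- by rewrite !ext_scale0.
- by rewrite !ext_scaleN h.
- by rewrite !ext_scaleDr h k.
Qed.
Lemma ext_scaleDl u : {morph ext_scale^~ u : a b / a + b}.
Proof.
move=> a b /=; elim/ext_ind: u => [c n||u h|u v h k].
- by rewrite !ext_scale_tens mulrDl tensDl.
- by rewrite !ext_scale0 addr0.
- by rewrite !ext_scaleN h opprD.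
- by rewrite !ext_scaleDr h k addrACA.
Qed.
HB.instance Definition _ := GRing.Zmodule_isLmodule.Build B ext_scalars
  ext_scaleA ext_scale1 ext_scaleDr ext_scaleDl.

Lemma scale_tens (b b' : B) n : b *: tens b' n = tens (b * b') n.
Proof. exact: ext_scale_tens. Qed.

Section Lift.
Variables (W : zmodType) (f : B -> N -> W).
Hypothesis fDl : forall b b' n, f (b + b') n = f b n + f b' n.
Hypothesis fDr : forall b n n', f b (n + n') = f b n + f b n'.
Hypothesis f_bal : forall b a n, f (b * phi a) n = f b (a *: n).

Fixpoint teval (t : tterm) : W :=
  match t with
  | TPure b n => f b n
  | TZero => 0
  | TOpp t => - teval t
  | TAdd s t => teval s + teval t
  end.

Lemma teval_eq s t : teq s t -> teval s = teval t.
Proof.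
elim=> //=.
- by move=> > _ -> _ ->.
- by move=> > _ ->.
- by move=> > _ -> _ ->.
- by move=> *; rewrite addrA.
- by move=> *; rewrite addrC.
- by move=> *; rewrite add0r.
- by move=> *; rewrite addNr.
Qed.

Definition ext_lift (u : ext_scalars) : W := teval (repr u).

Lemma ext_lift_pi s : ext_lift (\pi_ext_scalars s) = teval s.
Proof. by apply: teval_eq; exact: teq_repr. Qed.
Lemma ext_lift_tens b n : ext_lift (tens b n) = f b n.
Proof. by rewrite ext_lift_pi. Qed.
Lemma ext_liftD u v : ext_lift (u + v) = ext_lift u + ext_lift v.
Proof.
by elim/quotW: u => s; elim/quotW: v => t; rewrite -pi_TAdd !ext_lift_pi.
Qed.
Lemma ext_liftN u : ext_lift (- u) = - ext_lift u.
Proof. by elim/quotW: u => s; rewrite -pi_TOpp !ext_lift_pi. Qed.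
Lemma ext_lift0 : ext_lift 0 = 0.
Proof. by rewrite -pi_TZero ext_lift_pi. Qed.

End Lift.

End ExtensionOfScalars.

Section EnvelopeModule.
Variables (K : numFieldType) (g : lieSuperalgebra K) (V : superModule g).

Lemma actDl x y (v : V) : act (x + y) v = act x v + act y v.
Proof. by rewrite -[x]scale1r act_linl !scale1r. Qed.
Lemma actDr x (v w : V) : act x (v + w) = act x v + act x w.
Proof. by rewrite -[v]scale1r act_linr !scale1r. Qed.
Lemma act0r x : act x 0 = 0 :> V.
Proof. by apply: (addrI (act x 0)); rewrite -actDr !addr0. Qed.
Lemma actZr a x (v : V) : act x (a *: v) = a *: act x v.
Proof. by rewrite -[a *: v]addr0 act_linr act0r addr0. Qed.
Lemma actNr x (v : V) : act x (- v) = - act x v.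
Proof. by rewrite -scaleN1r actZr scaleN1r. Qed.

Lemma actNl x (v : V) : act (- x) v = - act x v.
Proof.
have act0l : act 0 v = 0 by apply: (addrI (act 0 v)); rewrite -actDl !addr0.
by apply: (addrI (act x v)); rewrite -actDl !subrr act0l.
Qed.

Fixpoint uact (t : uterm g) (v : V) : V :=
  match t with
  | UVar x => act x v
  | UConst a => a *: v
  | UAdd s t => uact s v + uact t v
  | UMul s t => uact s (uact t v)
  end.

Lemma uact_lin t (a : K) v w : uact t (a *: v + w) = a *: uact t v + uact t w.
Proof.
elim: t v w => [x|b|s hs t ht|s hs t ht] v w /=.
- exact: act_linr.
- by rewrite scalerDr !scalerA mulrC.
- by rewrite hs ht scalerDr addrACA.
- by rewrite ht hs.
Qed.

Lemma uactD t v w : uact t (v + w) = uact t v + uact t w.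
Proof. by rewrite -[v]scale1r uact_lin !scale1r. Qed.
Lemma uact0 t : uact t 0 = 0.
Proof. by apply: (addrI (uact t 0)); rewrite -uactD !addr0. Qed.
Lemma uactZ t a v : uact t (a *: v) = a *: uact t v.
Proof. by rewrite -[a *: v]addr0 uact_lin uact0 addr0. Qed.

Lemma uact_eq s t : ueq s t -> forall v, uact s v = uact t v.
Proof.
elim=> //=.
- by move=> > _ h _ k v; rewrite h k.
- by move=> > _ h _ k v; rewrite h k.
- by move=> > _ h _ k v; rewrite k h.
- by move=> *; rewrite addrA.
- by move=> s' t' v; rewrite addrC.
- by move=> *; rewrite scale0r add0r.
- by move=> *; rewrite scaleN1r addNr scale0r.
- by move=> *; rewrite scale1r.
- by move=> *; rewrite uactD.
- by move=> *; rewrite scalerDl.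
- by move=> *; rewrite scalerA.
- by move=> *; rewrite uactZ.
- by move=> *; rewrite act_linl.
- by move=> > hx hy v; rewrite -(act_bracket v hx hy) addrC subrK.
Qed.

(* V as a left U(g)-module. *)
Definition env_mod : Type := V.
HB.instance Definition _ := GRing.Zmodule.on env_mod.

Definition env_act (u : envalg g) (v : env_mod) : env_mod := uact (repr u) v.

Lemma env_act_pi s v : env_act (\pi_(envalg g) s) v = uact s v.
Proof. by apply: uact_eq; exact: ueq_repr. Qed.

Lemma env_actA u w v : env_act u (env_act w v) = env_act (u * w) v.
Proof.
by elim/quotW: u => s; elim/quotW: w => t; rewrite -pi_UMul !env_act_pi.
Qed.
Lemma env_act1 : left_id 1 env_act.
Proof. by move=> v; rewrite -[1]scale1r -pi_UConst env_act_pi /= scale1r. Qed.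
Lemma env_actDr : right_distributive env_act +%R.
Proof. by move=> u v w; exact: uactD. Qed.
Lemma env_actDl v : {morph env_act^~ v : u w / u + w}.
Proof.
by move=> /=; elim/quotW => s; elim/quotW => t; rewrite -pi_UAdd !env_act_pi.
Qed.
HB.instance Definition _ := GRing.Zmodule_isLmodule.Build (envalg g) env_mod
  env_actA env_act1 env_actDr env_actDl.

Lemma env_act_var x (v : env_mod) : env_var x *: v = act x (v : V).
Proof. exact: env_act_pi. Qed.
Lemma env_act_const (a : K) (v : env_mod) : (a%:A : envalg g) *: v = a *: (v : V).
Proof. by rewrite -pi_UConst; exact: env_act_pi. Qed.

End EnvelopeModule.

Section EnvelopeParity.
Variables (K : numFieldType) (g : lieSuperalgebra K).
Local Notation sig := (parity_inv (lsa_grading g)).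

Definition env_sig : envalg g -> envalg g := env_lift (fun x => env_var (sig x)).

Lemma env_sig_lin0 (a : K) x y :
  env_var (sig (a *: x + y)) = a *: env_var (sig x) + env_var (sig y).
Proof. by rewrite parity_inv_lin env_var_lin. Qed.

Lemma env_var0 : env_var (0 : g) = 0.
Proof.
have := env_var_lin 1 (0 : g) 0; rewrite !scale1r addr0 => e.
by apply: (addrI (env_var (0 : g))); rewrite addr0.
Qed.
Lemma env_varZ (a : K) (x : g) : env_var (a *: x) = a *: env_var x.
Proof. by rewrite -[a *: x]addr0 env_var_lin env_var0 addr0. Qed.

Lemma env_sig_br0 b c x y :
  hom (lsa_grading g) b x -> hom (lsa_grading g) c y ->
  env_var (sig x) * env_var (sig y)
    - (-1) ^+ (b && c) *: (env_var (sig y) * env_var (sig x))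
    = env_var (sig (bracket x y)).
Proof.
move=> hx hy; rewrite (parity_inv_hom hx) (parity_inv_hom hy).
rewrite (parity_inv_hom (bracket_hom hx hy)) !env_varZ -(env_var_bracket hx hy).
rewrite -!scalerAl -!scalerAr !scalerA scalerBr scalerA.
by rewrite signr_addb; congr (_ - _ *: _); rewrite -mulrA mulrC [_ ^+ c * _]mulrC.
Qed.

Lemma env_sigD u v : env_sig (u + v) = env_sig u + env_sig v.
Proof. exact: (env_liftD env_sig_lin0 env_sig_br0). Qed.
Lemma env_sigM u v : env_sig (u * v) = env_sig u * env_sig v.
Proof. exact: (env_liftM env_sig_lin0 env_sig_br0). Qed.
Lemma env_sigA (a : K) : env_sig a%:A = a%:A.
Proof. exact: (env_liftA env_sig_lin0 env_sig_br0). Qed.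
Lemma env_sig_var x : env_sig (env_var x) = env_var (sig x).
Proof. exact: (env_lift_var env_sig_lin0 env_sig_br0). Qed.
Lemma env_sigZ (a : K) u : env_sig (a *: u) = a *: env_sig u.
Proof. by rewrite -[u in LHS]mul1r scalerAl env_sigM env_sigA -scalerAl mul1r. Qed.

Lemma env_sig_hom b u : env_hom b u -> env_sig u = (-1) ^+ b *: u.
Proof.
elim=> {b u} [b|a|b x hx|b u v _ hu _ hv|b c u v _ hu _ hv].
- by rewrite scaler0 -[X in env_sig X](scale0r (1 : envalg g)) env_sigA scale0r.
- by rewrite env_sigA scale1r.
- by rewrite env_sig_var (parity_inv_hom hx) env_varZ.
- by rewrite env_sigD hu hv scalerDr.
- by rewrite env_sigM hu hv -scalerAl -scalerAr scalerA signr_addb.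
Qed.

Lemma env_hom_decomp (u : envalg g) : exists u0 u1,
  [/\ env_hom false u0, env_hom true u1 & u = u0 + u1].
Proof.
elim/env_ind: u => [x|a|u v|u v].
- have [x0 [x1 [h0 h1 ->]]] := hom_decomp (lsa_grading g) x.
  exists (env_var x0), (env_var x1); split; [exact: env_homX|exact: env_homX|].
  by rewrite -[x0 in LHS]scale1r env_var_lin scale1r.
- by exists a%:A, 0; split; [exact: env_homA|exact: env_hom0|rewrite addr0].
- move=> [u0 [u1 [h0 h1 ->]]] [v0 [v1 [k0 k1 ->]]].
  exists (u0 + v0), (u1 + v1); split; [exact: env_homD|exact: env_homD|].
  by rewrite addrACA.
- move=> [u0 [u1 [h0 h1 ->]]] [v0 [v1 [k0 k1 ->]]].
  exists (u0 * v0 + u1 * v1), (u0 * v1 + u1 * v0); split.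
  + by apply: env_homD; [exact: (env_homM h0 k0)|exact: (env_homM h1 k1)].
  + by apply: env_homD; [exact: (env_homM h0 k1)|exact: (env_homM h1 k0)].
  + by rewrite mulrDl !mulrDr [u1 * v0 + _]addrC addrACA.
Qed.

End EnvelopeParity.

Section Induced.
Variables (K : numFieldType) (g : lieSuperalgebra K) (S : subalgebra g).

Lemma env_incl_lin (a : K) (x y : S) :
  env_var (sub_val (a *: x + y)) = a *: env_var (sub_val x) + env_var (sub_val y).
Proof. by rewrite -env_var_lin -sub_val_lin. Qed.

Lemma env_incl_bracket b c (x y : S) :
  hom (lsa_grading S) b x -> hom (lsa_grading S) c y ->
  env_var (sub_val x) * env_var (sub_val y)
    - (-1) ^+ (b && c) *: (env_var (sub_val y) * env_var (sub_val x))
    = env_var (sub_val (bracket x y)).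
Proof. move=> hx hy; exact: (@env_var_bracket K g b c (sub_val x) (sub_val y) hx hy). Qed.

(* The morphism U(S) -> U(g) extending the inclusion of S in g. *)
Definition env_incl : envalg S -> envalg g :=
  env_lift (fun x : S => env_var (sub_val x)).

HB.instance Definition _ := GRing.isZmodMorphism.Build (envalg S) (envalg g)
  env_incl (env_lift_zmod env_incl_lin env_incl_bracket).
HB.instance Definition _ := GRing.isMonoidMorphism.Build (envalg S) (envalg g)
  env_incl (env_lift_monoid env_incl_lin env_incl_bracket).

Lemma env_incl_var x : env_incl (env_var x) = env_var (sub_val x).
Proof. exact: (env_lift_var env_incl_lin env_incl_bracket). Qed.
Lemma env_inclA (a : K) : env_incl a%:A = a%:A.
Proof. exact: (env_liftA env_incl_lin env_incl_bracket). Qed.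

Variable V : superModule S.

(* U(g) (x)_U(S) V, with its structure of K-vector space. *)
Definition ind_space : Type := ext_scalars env_incl (env_mod V).
HB.instance Definition _ := GRing.Zmodule.on ind_space.

Definition ind_scale (a : K) (t : ind_space) : ind_space :=
  (a%:A : envalg g) *: (t : ext_scalars env_incl (env_mod V)).

Lemma ind_scaleA a b t : ind_scale a (ind_scale b t) = ind_scale (a * b) t.
Proof. by rewrite /ind_scale scalerA -scalerAl mul1r scalerA. Qed.
Lemma ind_scale1 : left_id 1 ind_scale.
Proof. by move=> t; rewrite /ind_scale scale1r; exact: scale1r. Qed.
Lemma ind_scaleDr : right_distributive ind_scale +%R.
Proof. by move=> a t u; exact: scalerDr. Qed.
Lemma ind_scaleDl t : {morph ind_scale^~ t : a b / a + b}.
Proof. by move=> a b; rewrite /ind_scale scalerDl; exact: scalerDl. Qed.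
HB.instance Definition _ := GRing.Zmodule_isLmodule.Build K ind_space
  ind_scaleA ind_scale1 ind_scaleDr ind_scaleDl.

Definition ind_tens (u : envalg g) (v : V) : ind_space :=
  tens env_incl u (v : env_mod V).

Definition env_ind_act (u : envalg g) (t : ind_space) : ind_space :=
  u *: (t : ext_scalars env_incl (env_mod V)).

Definition ind_act (x : g) (t : ind_space) : ind_space := env_ind_act (env_var x) t.

Inductive ind_hom : bool -> ind_space -> Prop :=
  | ind_hom0 b : ind_hom b 0
  | ind_homD b t t' : ind_hom b t -> ind_hom b t' -> ind_hom b (t + t')
  | ind_homT b c u v : env_hom b u -> hom (smod_grading V) c v ->
      ind_hom (b (+) c) (ind_tens u v).

Lemma ind_tensDl u u' v : ind_tens (u + u') v = ind_tens u v + ind_tens u' v.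
Proof. exact: tensDl. Qed.
Lemma ind_tensDr u v v' : ind_tens u (v + v') = ind_tens u v + ind_tens u v'.
Proof. exact: (@tensDr _ _ env_incl (env_mod V)). Qed.
Lemma ind_tens_bal u w v : ind_tens (u * env_incl w) v = ind_tens u (env_act w v).
Proof. exact: tens_bal. Qed.
Lemma ind_tensZr (a : K) u v : ind_tens u (a *: v) = ind_tens (a *: u) v.
Proof.
have := ind_tens_bal u a%:A v; rewrite env_inclA -scalerAr mulr1 => ->.
by congr ind_tens; symmetry; exact: env_act_const.
Qed.
Lemma ind_actE u u' v : env_ind_act u (ind_tens u' v) = ind_tens (u * u') v.
Proof. exact: scale_tens. Qed.
Lemma ind_scaleE (a : K) (t : ind_space) : a *: t = env_ind_act a%:A t.
Proof. by []. Qed.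
Lemma ind_tensZ (a : K) u v : a *: ind_tens u v = ind_tens (a *: u) v.
Proof. by rewrite ind_scaleE ind_actE -scalerAl mul1r. Qed.
Lemma env_ind_actA u w t : env_ind_act u (env_ind_act w t) = env_ind_act (u * w) t.
Proof. exact: (scalerA u w (t : ext_scalars env_incl (env_mod V))). Qed.
Lemma env_ind_actDl u w t : env_ind_act (u + w) t = env_ind_act u t + env_ind_act w t.
Proof. exact: (scalerDl (t : ext_scalars env_incl (env_mod V)) u w). Qed.
Lemma env_ind_actDr u t t' : env_ind_act u (t + t') = env_ind_act u t + env_ind_act u t'.
Proof. exact: (scalerDr u (t : ext_scalars env_incl (env_mod V)) t'). Qed.
Lemma env_ind_act0 u : env_ind_act u 0 = 0.
Proof. by apply: (addrI (env_ind_act u 0)); rewrite -env_ind_actDr !addr0. Qed.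
Lemma env_ind_actZ (a : K) u t : env_ind_act (a *: u) t = a *: env_ind_act u t.
Proof. by rewrite ind_scaleE env_ind_actA -scalerAl mul1r. Qed.
Lemma env_ind_actZr (a : K) u t : env_ind_act u (a *: t) = a *: env_ind_act u t.
Proof. by rewrite !ind_scaleE !env_ind_actA -scalerAl -scalerAr mul1r mulr1. Qed.

Lemma ind_ind (P : ind_space -> Prop) : P 0 ->
  (forall t t', P t -> P t' -> P (t + t')) ->
  (forall u v, P (ind_tens u v)) -> forall t, P t.
Proof.
move=> h0 hD hT t; suff : P t /\ P (- t) by case.
elim/ext_ind: t => [u v||t [h k]|t t' [h k] [h' k']].
- split; first exact: hT.
  have -> : - tens env_incl u v = ind_tens (- u) v :> ind_space.
    by rewrite -[- u]scaleN1r -ind_tensZ scaleN1r.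
  exact: hT.
- by rewrite oppr0.
- by rewrite opprK.
- by rewrite opprD; split; apply: hD.
Qed.

Lemma sub_parity_inv (x : S) : sub_val (parity_inv (lsa_grading S) x)
  = parity_inv (lsa_grading g) (sub_val x).
Proof.
have [x0 [x1 [h0 h1 ->]]] := hom_decomp (lsa_grading S) x.
rewrite (parity_invE h0 h1) !sub_valD sub_valN; symmetry.
exact: parity_invE.
Qed.

Lemma env_sig_incl w : env_sig (env_incl w) = env_incl (env_sig w).
Proof.
elim/env_ind: w => [x|a|u v hu hv|u v hu hv].
- by rewrite env_incl_var !env_sig_var env_incl_var sub_parity_inv.
- by rewrite env_inclA !env_sigA env_inclA.
- by rewrite env_sigD !rmorphD /= env_sigD hu hv.
- by rewrite env_sigM !rmorphM /= env_sigM hu hv.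
Qed.

Local Notation sigV := (parity_inv (smod_grading V)).

Lemma sigVZ (a : K) v : sigV (a *: v) = a *: sigV v.
Proof.
have z : sigV 0 = 0.
  by rewrite (parity_inv_hom (hom0 (smod_grading V) false)) scaler0.
by rewrite -[a *: v]addr0 parity_inv_lin z addr0.
Qed.
Lemma sigVD v w : sigV (v + w) = sigV v + sigV w.
Proof. by rewrite -[v]scale1r parity_inv_lin !scale1r. Qed.

Lemma sigV_act (x : S) v : sigV (act x v) = act (parity_inv (lsa_grading S) x) (sigV v).
Proof.
have [x0 [x1 [h0 h1 ->]]] := hom_decomp (lsa_grading S) x.
have [v0 [v1 [k0 k1 ->]]] := hom_decomp (smod_grading V) v.
rewrite (parity_invE h0 h1) (parity_invE k0 k1) !(actDl, actDr, actNl, actNr).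
rewrite !sigVD (parity_inv_hom (act_hom h0 k0)) (parity_inv_hom (act_hom h1 k0)).
rewrite (parity_inv_hom (act_hom h0 k1)) (parity_inv_hom (act_hom h1 k1)) /=.
by rewrite !expr0 !expr1 !scale1r !scaleN1r opprK.
Qed.

Lemma sigV_env_act w (v : V) : sigV (env_act w v) = env_act (env_sig w) (sigV v).
Proof.
elim/env_ind: w v => [x|a|u u' hu hu'|u u' hu hu'] v.
- by rewrite env_sig_var !env_act_pi; exact: sigV_act.
- rewrite env_sigA; have e := @env_act_const K S V a.
  by rewrite [env_act _ v]e [RHS]e sigVZ.
- by rewrite env_sigD !env_actDl sigVD hu hu'.
- by rewrite env_sigM -!env_actA hu hu'.
Qed.

Definition ind_sig : ind_space -> ind_space :=
  ext_lift (fun (u : envalg g) (v : env_mod V) => ind_tens (env_sig u) (sigV v)).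

Lemma ind_sig_tens u v : ind_sig (ind_tens u v) = ind_tens (env_sig u) (sigV v).
Proof.
apply: ext_lift_tens => [b b' n|b n n'|b a n].
- by rewrite env_sigD ind_tensDl.
- by rewrite sigVD ind_tensDr.
- by rewrite env_sigM env_sig_incl ind_tens_bal -sigV_env_act.
Qed.
Lemma ind_sigD t t' : ind_sig (t + t') = ind_sig t + ind_sig t'.
Proof.
apply: ext_liftD => [b b' n|b n n'|b a n].
- by rewrite env_sigD ind_tensDl.
- by rewrite sigVD ind_tensDr.
- by rewrite env_sigM env_sig_incl ind_tens_bal -sigV_env_act.
Qed.

Lemma ind_sig_hom b t : ind_hom b t -> ind_sig t = (-1) ^+ b *: t.
Proof.
elim=> {b t} [b|b t t' _ h _ h'|b c u v hu hv].
- by rewrite scaler0; apply: (addrI (ind_sig 0)); rewrite -ind_sigD !addr0.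
- by rewrite ind_sigD h h' scalerDr.
- rewrite ind_sig_tens (env_sig_hom hu) (parity_inv_hom hv) ind_tensZr ind_tensZ.
  by rewrite scalerA signr_addb mulrC.
Qed.

Lemma ind_hom_lin b (a : K) t t' :
  ind_hom b t -> ind_hom b t' -> ind_hom b (a *: t + t').
Proof.
move=> h h'; apply: ind_homD h'; elim: h => {b t t'} [b|b t t' _ h _ h'|b c u v hu hv].
- by rewrite scaler0; exact: ind_hom0.
- by rewrite scalerDr; exact: ind_homD.
- rewrite ind_tensZ -[u]mul1r scalerAl -[b]addFb.
  by apply: ind_homT hv; apply: env_homM hu; exact: env_homA.
Qed.

Lemma ind_hom_decomp t : exists t0 t1,
  [/\ ind_hom false t0, ind_hom true t1 & t = t0 + t1].
Proof.
elim/ind_ind: t => [|t t'|u v].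
- by exists 0, 0; split; [exact: ind_hom0|exact: ind_hom0|rewrite addr0].
- move=> [u0 [u1 [h0 h1 ->]]] [v0 [v1 [k0 k1 ->]]].
  exists (u0 + v0), (u1 + v1); split; [exact: ind_homD|exact: ind_homD|].
  by rewrite addrACA.
- have [u0 [u1 [h0 h1 ->]]] := env_hom_decomp u.
  have [v0 [v1 [k0 k1 ->]]] := hom_decomp (smod_grading V) v.
  exists (ind_tens u0 v0 + ind_tens u1 v1), (ind_tens u0 v1 + ind_tens u1 v0).
  split.
  + by apply: ind_homD; [exact: (ind_homT h0 k0)|exact: (ind_homT h1 k1)].
  + by apply: ind_homD; [exact: (ind_homT h0 k1)|exact: (ind_homT h1 k0)].
  + by rewrite ind_tensDl !ind_tensDr [ind_tens u1 v0 + _]addrC addrACA.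
Qed.

Lemma ind_hom_disj t : ind_hom false t -> ind_hom true t -> t = 0.
Proof.
move=> h0 h1; have := ind_sig_hom h1.
rewrite (ind_sig_hom h0) expr0 scale1r expr1 scaleN1r => /eqP.
rewrite -subr_eq0 opprK -mulr2n -scaler_nat scaler_eq0 pnatr_eq0 /= => /eqP.
by [].
Qed.

Definition ind_grading : grading ind_space :=
  Grading ind_hom0 ind_hom_lin ind_hom_decomp ind_hom_disj.

Lemma ind_act_linl (a : K) x y t :
  ind_act (a *: x + y) t = a *: ind_act x t + ind_act y t.
Proof. by rewrite /ind_act env_var_lin env_ind_actDl env_ind_actZ. Qed.
Lemma ind_act_linr (a : K) x t t' :
  ind_act x (a *: t + t') = a *: ind_act x t + ind_act x t'.
Proof. by rewrite /ind_act env_ind_actDr env_ind_actZr. Qed.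
Lemma ind_act_hom b c x t : hom (lsa_grading g) b x -> ind_hom c t ->
  ind_hom (b (+) c) (ind_act x t).
Proof.
move=> hx; elim=> {c t} [c|c t t' _ h _ h'|c d u v hu hv].
- by rewrite /ind_act env_ind_act0; exact: ind_hom0.
- by rewrite /ind_act env_ind_actDr; exact: ind_homD.
- rewrite /ind_act ind_actE addbA; apply: ind_homT hv.
  by apply: env_homM hu; exact: env_homX.
Qed.
Lemma ind_act_bracket b c x y t :
  hom (lsa_grading g) b x -> hom (lsa_grading g) c y ->
  ind_act x (ind_act y t) - (-1) ^+ (b && c) *: ind_act y (ind_act x t)
    = ind_act (bracket x y) t.
Proof.
move=> hx hy; rewrite /ind_act -(env_var_bracket hx hy) !env_ind_actA -env_ind_actZ.
by rewrite -[- env_ind_act _ _]scaleN1r -env_ind_actZ -env_ind_actDl scaleN1r.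
Qed.

Definition induced : superModule g :=
  @SuperModule K g ind_space ind_grading ind_act ind_act_linl ind_act_linr
    ind_act_hom ind_act_bracket.

End Induced.

Inductive ramond_basis := RL of int | RG of int | RC.

Definition ramond_basis_code (k : ramond_basis) : option (int + int) :=
  match k with RL m => Some (inl m) | RG m => Some (inr m) | RC => None end.
Definition ramond_basis_decode (u : option (int + int)) : ramond_basis :=
  match u with Some (inl m) => RL m | Some (inr m) => RG m | None => RC end.
Lemma ramond_basis_codeK : cancel ramond_basis_code ramond_basis_decode.
Proof. by case. Qed.
HB.instance Definition _ := Choice.copy ramond_basis (can_type ramond_basis_codeK).

Definition ramond_odd (k : ramond_basis) : bool := if k is RG _ then true else false.

Section FreeModule.
Variables (K : numFieldType) (I : choiceType) (W : lmodType K) (f : I -> W).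
Local Notation F := {malg K[I]}.

Definition lin_ext (x : F) : W := \sum_(k <- msupp x) x@_k *: f k.

Lemma lin_extw (d : {fset I}) (x : F) : (msupp x `<=` d)%fset ->
  lin_ext x = \sum_(k <- d) x@_k *: f k.
Proof.
move=> le; rewrite /lin_ext; apply/big_fset_incl => // k _.
by move=> /mcoeff_outdom ->; rewrite scale0r.
Qed.

Lemma lin_ext_lin (a : K) (x y : F) :
  lin_ext (a *: x + y) = a *: lin_ext x + lin_ext y.
Proof.
pose d := (msupp x `|` msupp y)%fset.
have hx : (msupp x `<=` d)%fset by exact: fsubsetUl.
have hy : (msupp y `<=` d)%fset by exact: fsubsetUr.
have hxy : (msupp (a *: x + y) `<=` d)%fset.
  apply: fsubset_trans (msuppD_le _ _) _; rewrite fsubUset hy andbT.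
  exact: fsubset_trans (msuppZ_le _ _) hx.
rewrite !(lin_extw (d := d)) // scaler_sumr -big_split /=.
by apply: eq_bigr => k _; rewrite mcoeffD mcoeffZ scalerDl scalerA.
Qed.

Lemma lin_ext0 : lin_ext 0 = 0.
Proof. by rewrite /lin_ext msupp0 big_seq_fset0. Qed.
Lemma lin_extZ a x : lin_ext (a *: x) = a *: lin_ext x.
Proof. by rewrite -[a *: x]addr0 lin_ext_lin lin_ext0 addr0. Qed.
Lemma lin_extD x y : lin_ext (x + y) = lin_ext x + lin_ext y.
Proof. by rewrite -[x]scale1r lin_ext_lin !scale1r. Qed.
Lemma lin_extU k : lin_ext << k >> = f k.
Proof. by rewrite /lin_ext msuppU oner_eq0 big_seq_fset1 mcoeffUU scale1r. Qed.

End FreeModule.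

Section Ramond.
Variable K : numFieldType.
Local Notation F := {malg K[ramond_basis]}.

(* The cocycle of [L_m, L_n] is m^3 - m and not n^3 - n (these differ by a sign
   when n = - m): with [G_m, G_n] = - 2 L_(m+n) + (4 m^2 - 1)/12 C on the
   antidiagonal, n^3 - n violates the super Jacobi identity, e.g. on
   L_2, G_(-1), G_(-1).  Keeping n^3 - n and changing the sign of 4 m^2 - 1
   instead gives the same algebra after C |-> - C. *)
Definition ramond_br (i j : ramond_basis) : F :=
  match i, j with
  | RL m, RL n => (n - m)%:~R *: << RL (m + n) >>
      + ((m + n == 0)%:R * ((m ^+ 3 - m)%:~R / 12)) *: << RC >>
  | RG m, RG n => - 2 *: << RL (m + n) >>
      + ((m + n == 0)%:R * ((4 * m ^+ 2 - 1)%:~R / 12)) *: << RC >>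
  | RL m, RG n => (n%:~R - m%:~R / 2) *: << RG (m + n) >>
  | RG n, RL m => - (n%:~R - m%:~R / 2) *: << RG (m + n) >>
  | RC, _ | _, RC => 0
  end.

Definition ramond_bracket (x y : F) : F :=
  lin_ext (fun i => lin_ext (ramond_br i) y) x.

Lemma ramond_linl (a : K) x y z :
  ramond_bracket (a *: x + y) z = a *: ramond_bracket x z + ramond_bracket y z.
Proof. exact: lin_ext_lin. Qed.

Lemma ramond_linr (a : K) x y z :
  ramond_bracket z (a *: x + y) = a *: ramond_bracket z x + ramond_bracket z y.
Proof.
rewrite /ramond_bracket /lin_ext scaler_sumr -big_split /=.
apply: eq_bigr => k _; rewrite -!/(lin_ext _ _) lin_ext_lin scalerDr.
by rewrite !scalerA mulrC.
Qed.

Lemma ramond0l z : ramond_bracket 0 z = 0.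
Proof. exact: lin_ext0. Qed.
Lemma ramond0r z : ramond_bracket z 0 = 0.
Proof. by have := ramond_linr (-1) 0 0 z; rewrite scaler0 addr0 scaleN1r addNr. Qed.
Lemma ramondDl x y z : ramond_bracket (x + y) z = ramond_bracket x z + ramond_bracket y z.
Proof. by rewrite -[x]scale1r ramond_linl !scale1r. Qed.
Lemma ramondDr x y z : ramond_bracket z (x + y) = ramond_bracket z x + ramond_bracket z y.
Proof. by rewrite -[x]scale1r ramond_linr !scale1r. Qed.
Lemma ramondZl a x z : ramond_bracket (a *: x) z = a *: ramond_bracket x z.
Proof. by rewrite -[a *: x]addr0 ramond_linl ramond0l addr0. Qed.
Lemma ramondZr a x z : ramond_bracket z (a *: x) = a *: ramond_bracket z x.
Proof. by rewrite -[a *: x]addr0 ramond_linr ramond0r addr0. Qed.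
Lemma ramondU i j : ramond_bracket << i >> << j >> = ramond_br i j.
Proof. by rewrite /ramond_bracket !lin_extU. Qed.

(* Homogeneous elements: supported on basis elements of the given parity. *)
Definition ramond_hom b (x : F) : Prop :=
  forall k, k \in msupp x -> ramond_odd k = b.

Lemma ramond_homP b x :
  ramond_hom b x <-> (forall k, ramond_odd k != b -> x@_k = 0).
Proof.
split => h k; last first.
  by rewrite -mcoeff_neq0; apply: contraNeq => /h ->.
by case: (msuppP x k) => // hk; rewrite (h _ hk) eqxx.
Qed.

Lemma ramond_hom0 b : ramond_hom b 0.
Proof. by apply/ramond_homP => k _; rewrite mcoeff0. Qed.
Lemma ramond_hom_lin b (a : K) x y :
  ramond_hom b x -> ramond_hom b y -> ramond_hom b (a *: x + y).
Proof.
move=> /ramond_homP hx /ramond_homP hy; apply/ramond_homP => k hk.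
by rewrite mcoeffD mcoeffZ hx // hy // mulr0 addr0.
Qed.
Lemma ramond_homD b x y :
  ramond_hom b x -> ramond_hom b y -> ramond_hom b (x + y).
Proof. by move=> hx hy; rewrite -[x]scale1r; exact: ramond_hom_lin. Qed.
Lemma ramond_homZ b (a : K) x : ramond_hom b x -> ramond_hom b (a *: x).
Proof.
by move=> hx; rewrite -[_ *: _]addr0; apply: ramond_hom_lin => //; exact: ramond_hom0.
Qed.
Lemma ramond_homU k : ramond_hom (ramond_odd k) << k >>.
Proof. by move=> k'; rewrite msuppU oner_eq0 => /fset1P ->. Qed.
Lemma ramond_homUe b k : ramond_odd k = b -> ramond_hom b << k >>.
Proof. by move <-; exact: ramond_homU. Qed.

Lemma ramond_hom_ind (P : F -> Prop) b : P 0 ->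
  (forall (a : K) x y, P x -> P y -> P (a *: x + y)) ->
  (forall k, ramond_odd k = b -> P << k >>) ->
  forall x, ramond_hom b x -> P x.
Proof.
move=> h0 hl hU x hx; rewrite [x]monalgE.
rewrite big_seq; elim/big_ind: _ => //.
  by move=> y z hy hz; rewrite -[y]scale1r; exact: hl.
move=> k /hx hk; have -> : << x@_k *g k >> = x@_k *: << k >> :> F.
  by apply/malgP => k'; rewrite mcoeffZ !mcoeffU mulr_natr.
by rewrite -[_ *: _]addr0; apply: hl => //; exact: hU.
Qed.

Lemma ramond_hom_decomp x : exists x0 x1,
  [/\ ramond_hom false x0, ramond_hom true x1 & x = x0 + x1].
Proof.
pose part b : F := \sum_(k <- msupp x | ramond_odd k == b) << x@_k *g k >>.
have hp b : ramond_hom b (part b).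
  rewrite /part; elim/big_ind: _ => [|y z|k /eqP <-].
  - exact: ramond_hom0.
  - exact: ramond_homD.
  - by move=> k'; rewrite msuppU; case: ifP => // _ /fset1P ->.
exists (part false), (part true); split => //.
rewrite [LHS]monalgE (bigID (fun k => ramond_odd k == false)) /=.
by congr (_ + _); apply: eq_bigl => k; case: (ramond_odd k).
Qed.

Lemma ramond_hom_disj x : ramond_hom false x -> ramond_hom true x -> x = 0.
Proof.
move=> /ramond_homP h0 /ramond_homP h1; apply/malgP => k; rewrite mcoeff0.
by case e : (ramond_odd k); [apply: h0|apply: h1]; rewrite e.
Qed.

Definition ramond_grading : grading F :=
  Grading ramond_hom0 ramond_hom_lin ramond_hom_decomp ramond_hom_disj.

Lemma ramond_br_hom i j : ramond_hom (ramond_odd i (+) ramond_odd j) (ramond_br i j).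
Proof.
case: i j => [m|m|] [n|n|] /=; try exact: ramond_hom0.
- by apply: ramond_homD; apply/ramond_homZ/ramond_homUe.
- by apply/ramond_homZ/ramond_homUe.
- by apply/ramond_homZ/ramond_homUe.
- by apply: ramond_homD; apply/ramond_homZ/ramond_homUe.
Qed.

Lemma ramond_bracket_hom b c x y : ramond_hom b x -> ramond_hom c y ->
  ramond_hom (b (+) c) (ramond_bracket x y).
Proof.
move=> hx hy; elim/ramond_hom_ind: hx => [|a u v hu hv|i <-].
- by rewrite ramond0l; exact: ramond_hom0.
- by rewrite ramond_linl; exact: ramond_hom_lin.
elim/ramond_hom_ind: hy => [|a u v hu hv|j <-].
- by rewrite ramond0r; exact: ramond_hom0.
- by rewrite ramond_linr; exact: ramond_hom_lin.
by rewrite ramondU; exact: ramond_br_hom.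
Qed.

Lemma ramond_br_skew i j :
  ramond_br i j = - ((-1) ^+ (ramond_odd i && ramond_odd j) *: ramond_br j i).
Proof.
case: i j => [m|m|] [n|n|] /=; rewrite ?scaler0 ?oppr0 //.
- rewrite [n + m]addrC; apply/malgP => k; rewrite mcoeffN !(mcoeffD, mcoeffZ).
  have [/eqP|_] := eqVneq (m + n) 0; last by rewrite /= !mul0r; ring.
  by rewrite addr_eq0 => /eqP ->; field.
- by rewrite expr0 scale1r -scaleNr opprK.
- by rewrite expr0 scale1r -scaleNr.
- rewrite [n + m]addrC; apply/malgP => k; rewrite mcoeffN !(mcoeffD, mcoeffZ).
  have [/eqP|_] := eqVneq (m + n) 0; last by rewrite /= !mul0r; ring.
  by rewrite addr_eq0 => /eqP ->; field.
Qed.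

Lemma ramond_bracket_skew b c x y : ramond_hom b x -> ramond_hom c y ->
  ramond_bracket x y = - ((-1) ^+ (b && c) *: ramond_bracket y x).
Proof.
move=> hx hy; elim/ramond_hom_ind: hx => [|a u v hu hv|i <-].
- by rewrite ramond0l ramond0r scaler0 oppr0.
- by rewrite ramond_linl ramond_linr hu hv scalerDr !scalerA opprD scalerN scalerA mulrC.
elim/ramond_hom_ind: hy => [|a u v hu hv|j <-].
- by rewrite ramond0l ramond0r scaler0 oppr0.
- by rewrite ramond_linl ramond_linr hu hv scalerDr !scalerA opprD scalerN scalerA mulrC.
by rewrite !ramondU; exact: ramond_br_skew.
Qed.

Section JacobiBasis.
Variables (W : lmodType K) (B : W -> W -> W) (eL eG : int -> W) (eC : W).
Variable phi : W -> K.
Hypotheses (Dl : forall x y z, B (x + y) z = B x z + B y z)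
  (Dr : forall x y z, B z (x + y) = B z x + B z y)
  (Zl : forall a x z, B (a *: x) z = a *: B x z)
  (Zr : forall a x z, B z (a *: x) = a *: B z x)
  (phiD : forall x y, phi (x + y) = phi x + phi y)
  (phiZ : forall a x, phi (a *: x) = a * phi x).
Hypotheses
  (LL : forall m n, B (eL m) (eL n) = (n - m)%:~R *: eL (m + n)
    + ((m + n == 0)%:R * ((m ^+ 3 - m)%:~R / 12)) *: eC)
  (GG : forall m n, B (eG m) (eG n) = - 2 *: eL (m + n)
    + ((m + n == 0)%:R * ((4 * m ^+ 2 - 1)%:~R / 12)) *: eC)
  (LG : forall m n, B (eL m) (eG n) = (n%:~R - m%:~R / 2) *: eG (m + n))
  (GL : forall m n, B (eG n) (eL m) = - (n%:~R - m%:~R / 2) *: eG (m + n))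
  (LC : forall m, B (eL m) eC = 0) (CL : forall m, B eC (eL m) = 0)
  (GC : forall m, B (eG m) eC = 0) (CG : forall m, B eC (eG m) = 0)
  (CC : B eC eC = 0).

Definition basis_vec (k : ramond_basis) : W :=
  match k with RL m => eL m | RG m => eG m | RC => eC end.

Let Z_r x : B x 0 = 0.
Proof. by have := Zr 0 0 x; rewrite !scale0r. Qed.
Let Z_l x : B 0 x = 0.
Proof. by have := Zl 0 0 x; rewrite !scale0r. Qed.
Let phi0 : phi 0 = 0.
Proof. by have := phiZ 0 0; rewrite scale0r mul0r. Qed.

Let E1 m n p : m + (n + p) = m + n + p :> int. Proof. exact: addrA. Qed.
Let E2 m n p : n + (m + p) = m + n + p :> int. Proof. by rewrite addrCA addrA. Qed.
Let E3 m n p : p + (m + n) = m + n + p :> int. Proof. by rewrite addrC. Qed.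
Let E4 m n p : m + (p + n) = m + n + p :> int. Proof. by rewrite [p + n]addrC addrA. Qed.
Let E5 m n p : n + (p + m) = m + n + p :> int. Proof. by rewrite addrA [_ + m]addrC addrA. Qed.
Let E6 m n p : n + m + p = m + n + p :> int. Proof. by rewrite [n + m]addrC. Qed.
Let E7 m n p : p + (n + m) = m + n + p :> int. Proof. by rewrite addrC E6. Qed.

Let E8 m n p : m + p + n = m + n + p :> int. Proof. exact: addrAC. Qed.
Let E9 m n p : n + p + m = m + n + p :> int. Proof. by rewrite addrC addrA. Qed.

Lemma jacobi_basis i j l :
  phi (B (basis_vec i) (B (basis_vec j) (basis_vec l))) =
  phi (B (B (basis_vec i) (basis_vec j)) (basis_vec l)
    + (-1) ^+ (ramond_odd i && ramond_odd j) *: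
        B (basis_vec j) (B (basis_vec i) (basis_vec l))).
Proof.
case: i => [m|m|]; case: j => [n|n|]; case: l => [p|p|];
  rewrite /basis_vec /ramond_odd /andb ?expr0 ?expr1.
all: rewrite ?LL ?LG ?GL ?GG ?LC ?CL ?GC ?CG ?CC ?Dl ?Dr ?Zl ?Zr ?Z_l ?Z_r.
all: rewrite ?LL ?LG ?GL ?GG ?LC ?CL ?GC ?CG ?CC ?Dl ?Dr ?Zl ?Zr ?Z_l ?Z_r.
all: rewrite ?scaler0 ?addr0 ?Z_l ?Z_r ?scaler0 ?addr0 //.
all: rewrite ?(E1 m n p, E2 m n p, E3 m n p, E4 m n p, E5 m n p, E6 m n p, E7 m n p,
  E8 m n p, E9 m n p).
all: rewrite !(phiD, phiZ, phi0).
all: try by [move: (phi (eG _)) => e; field].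
all: move: (phi (eL _)) => e; move: (phi eC) => c.
all: have [/eqP|_] := eqVneq (m + n + p) 0; last by rewrite /= !mul0r; field.
all: by rewrite addrC addr_eq0 => /eqP ->; field.
Qed.
End JacobiBasis.

Lemma ramond_br_jacobi i j l :
  ramond_bracket << i >> (ramond_bracket << j >> << l >>) =
  ramond_bracket (ramond_bracket << i >> << j >>) << l >>
    + (-1) ^+ (ramond_odd i && ramond_odd j) *:
        ramond_bracket << j >> (ramond_bracket << i >> << l >>).
Proof.
apply/malgP => k.
pose eL m : F := << RL m >>; pose eG m : F := << RG m >>; pose eC : F := << RC >>.
have bv t : << t >> = basis_vec eL eG eC t by case: t.
rewrite !bv; apply: (jacobi_basis ramondDl ramondDr ramondZl ramondZr).
- exact: mcoeffD.
- by move=> a x; exact: mcoeffZ.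
all: by move=> *; exact: ramondU.
Qed.

Lemma ramond_bracket_jacobi b c d x y z :
  ramond_hom b x -> ramond_hom c y -> ramond_hom d z ->
  ramond_bracket x (ramond_bracket y z) =
    ramond_bracket (ramond_bracket x y) z
      + (-1) ^+ (b && c) *: ramond_bracket y (ramond_bracket x z).
Proof.
move=> hx hy hz.
elim/ramond_hom_ind: hx => [|a u v hu hv|i <-].
- by rewrite !(ramond0l, ramond0r) scaler0 addr0.
- rewrite !(ramond_linl, ramond_linr) hu hv !scalerDr !scalerA addrACA.
  by rewrite [_ * a]mulrC.
elim/ramond_hom_ind: hy => [|a u v hu hv|j <-].
- by rewrite !(ramond0l, ramond0r) scaler0 addr0.
- rewrite !(ramond_linl, ramond_linr) hu hv !scalerDr !scalerA addrACA.
  by rewrite [_ * a]mulrC.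
elim/ramond_hom_ind: hz => [|a u v hu hv|l _].
- by rewrite !(ramond0l, ramond0r) scaler0 addr0.
- rewrite !(ramond_linl, ramond_linr) hu hv !scalerDr !scalerA addrACA.
  by rewrite [_ * a]mulrC.
exact: ramond_br_jacobi.
Qed.

Definition ramond : lieSuperalgebra K :=
  @LieSuperalgebra K F ramond_grading ramond_bracket ramond_linl ramond_linr
    ramond_bracket_hom ramond_bracket_skew ramond_bracket_jacobi.

(* B = span {L_m, G_m | m >= 1} (+) K L_0 (+) K C. *)
Definition ramondB_basis (k : ramond_basis) : bool :=
  match k with RL m => 0 <= m | RG m => 1 <= m | RC => true end.

Definition ramondB_mem : pred ramond :=
  fun x : F => all ramondB_basis (msupp x).

Lemma ramondB_memP (x : F) :
  ramondB_mem x <-> (forall k, ~~ ramondB_basis k -> x@_k = 0).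
Proof.
split => [/allP h k hk|h].
  by case: (msuppP x k) => // /h; rewrite (negbTE hk).
apply/allP => k; rewrite -mcoeff_neq0; apply: contraNT => /h ->.
by rewrite eqxx.
Qed.

Lemma ramondB_mem0 : ramondB_mem 0.
Proof. by apply/ramondB_memP => k _; rewrite mcoeff0. Qed.
Lemma ramondB_mem_lin (a : K) (x y : F) :
  ramondB_mem x -> ramondB_mem y -> ramondB_mem (a *: x + y).
Proof.
move=> /ramondB_memP hx /ramondB_memP hy; apply/ramondB_memP => k hk.
by rewrite mcoeffD mcoeffZ hx // hy // mulr0 addr0.
Qed.
Lemma ramondB_memZ (a : K) (x : F) : ramondB_mem x -> ramondB_mem (a *: x).
Proof.
by move=> hx; rewrite -[_ *: _]addr0; apply: ramondB_mem_lin => //; exact: ramondB_mem0.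
Qed.
Lemma ramondB_memU k : ramondB_basis k -> ramondB_mem << k >>.
Proof.
by move=> hk; apply/allP => k'; rewrite msuppU oner_eq0 => /fset1P ->.
Qed.

Lemma ramondB_mem_ind (P : F -> Prop) : P 0 ->
  (forall (a : K) x y, P x -> P y -> P (a *: x + y)) ->
  (forall k, ramondB_basis k -> P << k >>) ->
  forall x, ramondB_mem x -> P x.
Proof.
move=> h0 hl hU x /allP hx; rewrite [x]monalgE.
rewrite big_seq; elim/big_ind: _ => //.
  by move=> y z hy hz; rewrite -[y]scale1r; exact: hl.
move=> k /hx hk; have -> : << x@_k *g k >> = x@_k *: << k >> :> F.
  by apply/malgP => k'; rewrite mcoeffZ !mcoeffU mulr_natr.
by rewrite -[_ *: _]addr0; apply: hl => //; exact: hU.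
Qed.

Lemma ramondB_mem_graded (x : F) : ramondB_mem x -> exists x0 x1 : F,
  [/\ ramondB_mem x0 && ramondB_mem x1, ramond_hom false x0,
      ramond_hom true x1 & x = x0 + x1].
Proof.
elim/ramondB_mem_ind => [|a u v|k hk].
- by exists 0, 0; split; rewrite ?ramondB_mem0 ?addr0 //; exact: ramond_hom0.
- move=> [u0 [u1 [/andP[m0 m1] h0 h1 ->]]] [v0 [v1 [/andP[n0 n1] k0 k1 ->]]].
  exists (a *: u0 + v0), (a *: u1 + v1); split.
  + by apply/andP; split; exact: ramondB_mem_lin.
  + exact: ramond_hom_lin.
  + exact: ramond_hom_lin.
  + by rewrite scalerDr addrACA.
- case e : (ramond_odd k).
  + exists 0, << k >>; split; rewrite ?ramondB_mem0 ?ramondB_memU ?add0r //.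
      exact: ramond_hom0.
    exact: ramond_homUe.
  + exists << k >>, 0; split; rewrite ?ramondB_mem0 ?ramondB_memU ?addr0 //.
      exact: ramond_homUe.
    exact: ramond_hom0.
Qed.

Lemma ramondB_br i j : ramondB_basis i -> ramondB_basis j -> ramondB_mem (ramond_br i j).
Proof.
case: i j => [m|m|] [n|n|] //= hm hn; try exact: ramondB_mem0.
- rewrite -[X in _ + X]addr0; apply: ramondB_mem_lin; last first.
    by apply: ramondB_mem_lin; [exact: ramondB_memU|exact: ramondB_mem0].
  by apply: ramondB_memU; exact: addr_ge0.
- by apply/ramondB_memZ/ramondB_memU; apply: le_trans hn _; rewrite lerDr.
- by apply/ramondB_memZ/ramondB_memU; apply: le_trans hm _; rewrite lerDr.
- rewrite -[X in _ + X]addr0; apply: ramondB_mem_lin; last first.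
    by apply: ramondB_mem_lin; [exact: ramondB_memU|exact: ramondB_mem0].
  by apply: ramondB_memU; apply: addr_ge0; apply: le_trans ler01 _.
Qed.

Lemma ramondB_mem_bracket (x y : F) :
  ramondB_mem x -> ramondB_mem y -> ramondB_mem (ramond_bracket x y).
Proof.
move=> hx hy; elim/ramondB_mem_ind: hx => [|a u v hu hv|i hi].
- by rewrite ramond0l; exact: ramondB_mem0.
- by rewrite ramond_linl; exact: ramondB_mem_lin.
elim/ramondB_mem_ind: hy => [|a u v hu hv|j hj].
- by rewrite ramond0r; exact: ramondB_mem0.
- by rewrite ramond_linr; exact: ramondB_mem_lin.
by rewrite ramondU; exact: ramondB_br.
Qed.

Definition ramondB : subalgebra ramond :=
  @Subalgebra K ramond ramondB_mem ramondB_mem0 ramondB_mem_lin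
    ramondB_mem_graded ramondB_mem_bracket.

(* The basis element k as an element of B; 0 if k is not in B. *)
Definition ramondB_elt (k : ramond_basis) : ramondB :=
  insubd (0 : sub_sort ramondB) (<< k >> : F).

Lemma ramondB_eltE k : ramondB_basis k -> sub_val (ramondB_elt k) = << k >>.
Proof. by move=> hk; apply: insubdK; exact: ramondB_memU. Qed.

End Ramond.

(* Main.v *)
Require Import Defs.
From mathcomp Require Import all_boot all_order all_algebra.
From mathcomp Require Import reals complex.
From mathcomp Require Import boolp functions.
From mathcomp.multinomials Require Import monalg.
From mathcomp Require Import ring zify.

(* M = Ind V is spanned by the words y_1 ... y_k (1 (x) v) in the lowering
   letters y = L_(-n) (n >= 1), G_(-n) (n >= 0). Order words by (weight, length),
   where L_(-n) and G_(-n) have weight n. The element x of degree r + n and of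
   the same parity as y is dual to y: modulo words of lower (weight, length), it
   acts as L_r on V times a nonzero multiple of the derivation d/dy. Hence if W
   is a submodule in which 1 (x) v lies only for v = 0, and the top part T of an
   element of W is given by coefficients v_i, induction on the length shows that
   every d/dy T is zero modulo lower terms, and so is k T = sum_y y (d/dy T)
   (Euler), k being the length; thus W = 0. This formal cancellation needs no
   linear independence of the words.

   That V embeds in Ind V needs part of the Poincare-Birkhoff-Witt theorem: a
   right R-module structure on U(B) + G_0 U(B) extending right multiplication by
   U(B), on which u |-> 1 u splits U(B) -> U(R). The action of z is read off from
   the right B-module Hom(R, U(B) + G_0 U(B)), in which s in U(B) moves the
   initial value z |-> 1 z (respectively z |-> G_0 z) to z |-> s z
   (respectively z |-> G_0 s z). *)

Set Implicit Arguments.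
Unset Strict Implicit.
Unset Printing Implicit Defensive.

Import Order.TTheory GRing.Theory Num.Theory.
Local Open Scope ring_scope.
Local Open Scope quotient_scope.

Local Notation hom := Defs.hom.

(** * Words in the lowering generators *)

(* The letter (b, n) stands for the lowering generator L_(-n-1) if b = false
   and G_(-n) if b = true. *)
Definition letter := (bool * nat)%type.
Definition dg (a : letter) : int := (a.2 + ~~ a.1)%N%:Z.
Definition wt (s : seq letter) : int := foldr (fun a w => dg a + w) 0 s.

Lemma dg_ge0 a : 0 <= dg a. Proof. by []. Qed.

Lemma dg_inj (a a' : letter) : a.1 = a'.1 -> dg a = dg a' -> a = a'.
Proof. by case: a a' => b n [b' n'] /= <- [] /addIn ->. Qed.

Lemma wt_ge0 s : 0 <= wt s.
Proof. by elim: s => //= a s; have := dg_ge0 a; lia. Qed.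

Section Words.
Variables (K : numFieldType) (M V : lmodType K).
(** [e b m] stands for the action of [L_m] if [b = false] and of [G_m] if [b = true]; [kap] and
    [zet] are the structure constants, the central element being already replaced by a scalar. *)
Variables (e : bool -> int -> M -> M) (kap zet : bool -> int -> bool -> int -> K).
Variable iota : V -> M.
Hypothesis e_lin : forall b m a u v, e b m (a *: u + v) = a *: e b m u + e b m v.
Hypothesis e_comm : forall b m b' n u, e b m (e b' n u) =
  (-1) ^+ (b && b') *: e b' n (e b m u)
    + kap b m b' n *: e (b (+) b') (m + n) u + zet b m b' n *: u.
Hypothesis zet0 : forall b (m : int) b' (n : int), m + n != 0 -> zet b m b' n = 0.
Hypothesis iota_lin : forall a u v, iota (a *: u + v) = a *: iota u + iota v.

Lemma e0 b m : e b m 0 = 0.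
Proof. by have := e_lin b m (-1) 0 0; rewrite scaler0 addr0 scaleN1r addNr. Qed.
Lemma eD b m u v : e b m (u + v) = e b m u + e b m v.
Proof. by have := e_lin b m 1 u v; rewrite !scale1r. Qed.
Lemma eZ b m a u : e b m (a *: u) = a *: e b m u.
Proof. by rewrite -[a *: u]addr0 e_lin e0 addr0. Qed.
Lemma iota0 : iota 0 = 0.
Proof. by have := iota_lin (-1) 0 0; rewrite scaler0 addr0 scaleN1r addNr. Qed.

Definition word (s : seq letter) (v : V) : M :=
  foldr (fun a u => e a.1 (- dg a) u) (iota v) s.

Lemma word_lin s a u v : word s (a *: u + v) = a *: word s u + word s v.
Proof. by elim: s => [|x s /= ->]; [exact: iota_lin|exact: e_lin]. Qed.
Lemma word0 s : word s 0 = 0.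
Proof. by elim: s => [|x s /= ->]; [exact: iota0|exact: e0]. Qed.
Lemma wordZ s a u : word s (a *: u) = a *: word s u.
Proof. by rewrite -[a *: u]addr0 word_lin word0 addr0. Qed.

(* The span of the words of (weight, length) lexicographically below (w, l). *)
Inductive low (w l : int) : M -> Prop :=
  | low0 : low w l 0
  | lowD u u' : low w l u -> low w l u' -> low w l (u + u')
  | low_word s v : (wt s < w) || ((wt s == w) && ((size s)%:Z < l)) ->
      low w l (word s v).

Lemma lowZ w l a u : low w l u -> low w l (a *: u).
Proof.
elim=> [|x y _ hx _ hy|s v h]; rewrite ?scaler0 ?scalerDr -?wordZ; by constructor.
Qed.
Lemma lowN w l u : low w l u -> low w l (- u).
Proof. by rewrite -scaleN1r; exact: lowZ. Qed.
Lemma lowB w l u v : low w l u -> low w l v -> low w l (u - v).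
Proof. by move=> hu hv; apply: lowD => //; apply: lowN. Qed.
Lemma lowBl w l u v : low w l (u - v) -> low w l v -> low w l u.
Proof. by move=> h hv; rewrite -[u](subrK v); apply: lowD. Qed.
Lemma low_sum w l (I : Type) (s : seq I) (P : pred I) (F : I -> M) :
  (forall i, P i -> low w l (F i)) -> low w l (\sum_(i <- s | P i) F i).
Proof. by move=> h; elim/big_ind: _ => //; [exact: low0|exact: lowD]. Qed.

Lemma low_le (w l w' l' : int) u : (w < w') || ((w == w') && (l <= l')) ->
  low w l u -> low w' l' u.
Proof.
move=> hw; elim=> [|x y _ hx _ hy|s v h]; [exact: low0|exact: lowD|].
by apply: low_word; lia.
Qed.

Lemma low00 u : low 0 0 u -> u = 0.
Proof.
elim=> // [x y _ -> _ ->|s v h]; first by rewrite addr0.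
by have := wt_ge0 s; lia.
Qed.

(** A new letter raises the length by one, hence the condition [l < l']. If [l <= 0], only words of
    weight below [w] occur and their lengths do not matter. *)
Lemma low_cons a (w l w' l' : int) u : w' = w + dg a ->
  (l < l') || (l <= 0) -> low w l u -> low w' l' (e a.1 (- dg a) u).
Proof.
move=> -> hl; elim=> [|x y _ hx _ hy|s v h].
- by rewrite e0; exact: low0.
- by rewrite eD; exact: lowD.
- by apply: (@low_word _ _ (a :: s) v) => /=; lia.
Qed.

Definition spanned (u : M) := exists w l : nat, low w%:Z l%:Z u.

Lemma spannedD u v : spanned u -> spanned v -> spanned (u + v).
Proof.
move=> [w [l hu]] [w' [l' hv]]; exists (w + w').+1, 0%N.
by apply: lowD; [apply: low_le hu|apply: low_le hv]; lia.
Qed.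

Lemma spannedZ a u : spanned u -> spanned (a *: u).
Proof. by move=> [w [l hu]]; exists w, l; exact: lowZ. Qed.

Lemma spanned_iota v : spanned (iota v).
Proof. by exists 1%N, 0%N; apply: (@low_word _ _ [::] v). Qed.

(** * The action of a generator on a word *)

Variables (r : int) (Lr : V -> V).
Hypothesis kap_dual : forall a : letter, kap a.1 (r + dg a) a.1 (- dg a) != 0.
Hypothesis Lr_lin : forall a u v, Lr (a *: u + v) = a *: Lr u + Lr v.
Hypothesis Lr_inj : forall v, Lr v = 0 -> v = 0.
Hypothesis r_gt0 : 0 < r.
Hypothesis e_top : forall v, e false r (iota v) = iota (Lr v).
Hypothesis e_kill : forall b (d : int) v, r <= d -> b || (d != r) -> e b d (iota v) = 0.
(** The condition selects [L_d] with [d >= 0] and [G_d] with [d >= 1], the generators that belong to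
    the subalgebra acting on [V]. *)
Hypothesis e_absorb : forall (b : bool) (d : int) v, b%:Z <= d ->
  exists v', e b d (iota v) = iota v'.

(** The generator is moved to the right; each letter [a] that it crosses leaves a commutator of
    degree [d - dg a] on a shorter word. Whatever reaches [V] in degree at least [r] dies, except
    [L_r]; whatever reaches it in degree below [r] ends at a weight below [wt s + r - d]. So this
    weight is attained only through [L_r], and, apart from the subtracted term, on words shorter
    than [s]. *)
Lemma gen_word s v b (d : int) :
  low (wt s + r - d) (if d < r then 0 else (size s)%:Z)
    (e b d (word s v) - (if ~~ b && (d == r) then word s (Lr v) else 0)).
Proof.
elim: s v b d => [|a s IH] v b d /=.
  have [/andP[hb /eqP ->]|hb] := boolP (~~ b && (d == r)).
    by case: b hb => // _; rewrite e_top subrr; exact: low0.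
  rewrite subr0 add0r; case: (ltrP d r) => hd; last first.
    by rewrite e_kill //; [exact: low0|lia].
  have [h|h] := lerP b%:Z d.
    by have [v' ->] := e_absorb v h; apply: (@low_word _ _ [::] v') => /=; lia.
  (* A generator that is neither killed nor absorbed is itself a letter; its weight [- d] is below
     [r - d] because [0 < r]. *)
  case: b h hb => h hb.
    have -> : d = - dg (true, `|d|%N) by rewrite /dg /=; lia.
    by apply: (@low_word _ _ [:: (true, `|d|%N)] v); rewrite /= /dg /=; lia.
  have -> : d = - dg (false, `|d|%N.-1) by rewrite /dg /=; lia.
  by apply: (@low_word _ _ [:: (false, `|d|%N.-1)] v); rewrite /= /dg /=; lia.
rewrite e_comm.
have IHc : low (dg a + wt s + r - d) (if d < r then 0 else (size s).+1%:Z)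
    (e a.1 (- dg a) (e b d (word s v)) -
       (if ~~ b && (d == r) then e a.1 (- dg a) (word s (Lr v)) else 0)).
  have -> : (if ~~ b && (d == r) then e a.1 (- dg a) (word s (Lr v)) else 0) =
    e a.1 (- dg a) (if ~~ b && (d == r) then word s (Lr v) else 0).
    by case: ifP; rewrite ?e0.
  rewrite -[- e _ _ _]scaleN1r -eZ -eD scaleN1r.
  by apply: low_cons (IH v b d); [lia|case: (ltrP d r) => ?; lia].
have sgn : ~~ b && (d == r) -> (-1) ^+ (b && a.1) = 1 :> K by case: (b).
rewrite -[_ + _ *: _ + _ *: _]addrA [_ *: _ + _ - _]addrAC; apply: lowD.
  move: IHc; have [/sgn hs|_] := boolP (~~ b && (d == r)).
    by rewrite hs scale1r.
  by rewrite !subr0; exact: lowZ.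
apply: lowD; last first.
  have [h|/zet0 ->] := eqVneq (d - dg a) 0; last by rewrite scale0r; exact: low0.
  by apply: lowZ; apply: low_word; apply/orP; left; lia.
apply: lowZ.
have := IH v (b (+) a.1) (d - dg a); have := dg_ge0 a => ha.
(* If the commutator is [L_r], its leading term [word s (Lr v)] has the bounding weight but has lost
   the letter [a]. *)
have [/andP[hb /eqP hd]|_] := boolP (~~ (b (+) a.1) && (d - dg a == r)).
  move=> h; apply: (lowBl (v := word s (Lr v))).
    by apply: low_le h; case: (ltrP d r) => ?; case: (ltrP (d - dg a) r) => ?; lia.
  by apply: low_word; case: (ltrP d r) => ?; lia.
by rewrite subr0; apply: low_le; case: (ltrP d r) => ?;
  case: (ltrP (d - dg a) r) => ?; lia.
Qed.

(** Such a generator is a letter and is simply prefixed, except [L_0], which is commuted through the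
    word and absorbed by [V]. Prefixing gives length [size s + 1], hence the strict bound
    [size s + 2]. *)
Lemma neg_word s v b (d : int) : d <= 0 ->
  low (wt s - d) ((size s)%:Z + 2) (e b d (word s v)).
Proof.
move=> hd; have [hb|hb] := boolP (b || (d < 0)).
  have [a ha ->] : exists2 a : letter, a.1 = b & d = - dg a.
    case: b hb => /= hb; first by exists (true, `|d|%N); rewrite // /dg /=; lia.
    by exists (false, `|d|%N.-1); rewrite // /dg /=; lia.
  by rewrite -ha; apply: (@low_word _ _ (a :: s) v) => /=; lia.
have [-> ->] : b = false /\ d = 0 by case: b hb => //= hb; lia.
elim: s => [|a s IH] /=.
  have [|v' ->] := @e_absorb false 0 v; first by [].
  by apply: (@low_word _ _ [::] v'); rewrite /=; lia.
rewrite e_comm /= scale1r add0r; apply: lowD; first apply: lowD.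
- by apply: low_cons IH; lia.
- by apply: lowZ; apply: (@low_word _ _ (a :: s) v) => /=; lia.
- have [ha|/zet0 ->] := eqVneq (0 - dg a) 0; last by rewrite scale0r; exact: low0.
  by apply: lowZ; apply: low_word; lia.
Qed.

Lemma low_neg b (d w l w' l' : int) u : d <= 0 -> w' = w - d -> l' = l + 1 ->
  low w l u -> low w' l' (e b d u).
Proof.
move=> hd -> ->; elim=> [|x y _ hx _ hy|s v h].
- by rewrite e0; exact: low0.
- by rewrite eD; exact: lowD.
- by apply: low_le (neg_word s v b hd); lia.
Qed.

(** * Contractions of words and the Euler identity *)

Definition family := seq (seq letter * V).
(** Contractions are defined on formal sums and evaluated afterwards, since distinct words are not
    known to be independent in [M]. *)
Definition ev (E : family) : M := \sum_(p <- E) word p.1 p.2.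
Definition homog (w l : int) (E : family) : Prop :=
  forall (s : seq letter) (v : V), (s, v) \in E -> wt s = w /\ (size s)%:Z = l.

Lemma ev_nil : ev [::] = 0. Proof. exact: big_nil. Qed.
Lemma ev_cat E E' : ev (E ++ E') = ev E + ev E'. Proof. exact: big_cat. Qed.

Lemma homog_low (w l l' : int) E : homog w l E -> l < l' -> low w l' (ev E).
Proof.
move=> h hl; rewrite /ev big_seq; apply: low_sum => -[s v] /h[hw hs].
by apply: low_word; rewrite hw hs eqxx hl orbT.
Qed.

Let kd (a : letter) := kap a.1 (r + dg a) a.1 (- dg a).

(* The formal contraction of the word s by the letter a: the leading term of
   the action of the generator of degree r + dg a dual to a. *)
Fixpoint contr (a : letter) (s : seq letter) (v : V) : family :=
  if s is y :: s' then
    (if y == a then [:: (s', kd a *: v)] else [::])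
      ++ [seq (y :: p.1, (-1) ^+ (a.1 && y.1) *: p.2) | p <- contr a s' v]
  else [::].

Lemma ev_prefix (y : letter) (x : K) E :
  ev [seq (y :: p.1, x *: p.2) | p <- E] = x *: e y.1 (- dg y) (ev E).
Proof.
rewrite /ev big_map; elim: E => [|p E IH]; first by rewrite !big_nil e0 scaler0.
by rewrite !big_cons IH eD scalerDr /= wordZ eZ.
Qed.

Lemma ev_contr_cons a y s v : ev (contr a (y :: s) v) =
  (if y == a then kd a *: word s v else 0)
    + (-1) ^+ (a.1 && y.1) *: e y.1 (- dg y) (ev (contr a s v)).
Proof.
rewrite ev_cat ev_prefix; congr (_ + _).
by case: ifP => _; rewrite /ev ?big_nil // big_seq1 wordZ.
Qed.

Lemma contr_homog a s v : homog (wt s - dg a) ((size s)%:Z - 1) (contr a s v).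
Proof.
elim: s => //= y s IH t u.
rewrite mem_cat => /orP[|/mapP[[t' u'] /IH[h1 h2] [-> _]]] /=.
  by case: ifP => // /eqP <-; rewrite inE => /eqP[-> _]; lia.
by lia.
Qed.

(** Crossing a letter [y] leaves a commutator of degree [r + dg a - dg y]. It is an [L_r] only if
    [y] and [a] agree in parity and weight, that is if [y = a]; then it contributes [kd a] times
    [word s (Lr v)], the Leibniz term of the contraction. By [gen_word] every other contribution is
    low. *)
Lemma dual_word a s v : low (wt s - dg a) ((size s)%:Z - 1)
  (e a.1 (r + dg a) (word s v) - ev (contr a s (Lr v))).
Proof.
have ha := dg_ge0 a.
elim: s => [|y s IH].
  (* On the empty word the dual generator acts by zero: an even letter has weight at least 1, so its
     dual is not [L_r]. *)
  rewrite ev_nil subr0 /= e_kill; first exact: low0; first by lia.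
  by case: a ha => [[] n] //=; rewrite /dg /=; lia.
have hy := dg_ge0 y.
rewrite ev_contr_cons /= e_comm.
set X := e a.1 _ _; set Y := ev _; set k := kap _ _ _ _; set z := zet _ _ _ _.
have -> : forall A B C D : M, A + B + C - (D + (-1) ^+ (a.1 && y.1) *: e y.1 (- dg y) Y)
    = (A - (-1) ^+ (a.1 && y.1) *: e y.1 (- dg y) Y) + (B - D) + C.
  by move=> A B C D; rewrite opprD addrAC [- D - _]addrC addrACA.
rewrite -scalerBr -[- e _ _ Y]scaleN1r -eZ -eD scaleN1r.
apply: lowD; first apply: lowD.
- by apply: lowZ; apply: low_cons IH; lia.
- case: eqVneq => [hya|hya].
    have -> : k = kd a by rewrite /k hya.
    rewrite -scalerBr; apply: lowZ; rewrite hya addbb addrK.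
    have := gen_word s v false r; rewrite ltxx eqxx /=; apply: low_le; lia.
  rewrite subr0; apply: lowZ.
  have := gen_word s v (a.1 (+) y.1) (r + dg a - dg y).
  have [/andP[h1 h2]|_] := boolP (~~ _ && _).
    have hb : y.1 = a.1 by case: (y.1) (a.1) h1 => [] [].
    by case/eqP: hya; apply: dg_inj => //; lia.
  by rewrite subr0; apply: low_le; case: (ltrP (r + dg a - dg y) r) => ?; lia.
- have [h|/zet0 hz] := eqVneq (r + dg a - dg y) 0; last first.
    by rewrite /z hz scale0r; exact: low0.
  by apply: lowZ; apply: low_word; apply/orP; left; lia.
Qed.

Lemma dual_low a (w l w' l' : int) u : w' = w - dg a -> l' = l - 1 ->
  low w l u -> low w' l' (e a.1 (r + dg a) u).
Proof.
move=> -> ->; elim=> [|x y _ hx _ hy|s v h].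
- by rewrite e0; exact: low0.
- by rewrite eD; exact: lowD.
have h1 := dual_word a s v.
apply: (lowBl (v := ev (contr a s (Lr v)))); first by apply: low_le h1; lia.
have : low (wt s - dg a) (size s)%:Z (ev (contr a s (Lr v))).
  by apply: (homog_low (@contr_homog a s _)); lia.
by apply: low_le; lia.
Qed.

(** Contracting by [a] and prefixing [a] moves one occurrence of [a] to the front. Moving it back
    costs only commutators, which are low, so each of the [size s] occurrences returns the word
    itself. *)
Lemma euler_word (A s : seq letter) v : uniq A -> {subset s <= A} ->
  low (wt s) (size s)%:Z
    (\sum_(a <- A) (kd a)^-1 *: e a.1 (- dg a) (ev (contr a s v))
       - (size s)%:R *: word s v).
Proof.
move=> uA; elim: s => [|y s IH] sA.
  rewrite scale0r subr0 big1 ?ev_nil; first exact: low0.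
  by move=> a _; rewrite ev_nil e0 scaler0.
have yA : y \in A by apply: sA; rewrite mem_head.
have {}IH : low (wt s) (size s)%:Z _ :=
  IH (fun z hz => sA z (mem_behead (s := y :: s) hz)).
pose T a := (kd a)^-1 *: e a.1 (- dg a) (ev (contr a s v)).
have step a : low (wt (y :: s)) (size (y :: s))%:Z
   ((kd a)^-1 *: e a.1 (- dg a) (ev (contr a (y :: s) v))
     - ((if y == a then word (y :: s) v else 0) + e y.1 (- dg y) (T a))).
  rewrite ev_contr_cons eD eZ scalerDr.
  have -> : (kd a)^-1 *: e a.1 (- dg a) (if y == a then kd a *: word s v else 0)
     = if y == a then word (y :: s) v else 0.
    case: eqP => [->|_]; last by rewrite e0 scaler0.
    by rewrite eZ scalerA mulVf ?scale1r //; exact: kap_dual.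
  rewrite opprD addrACA subrr add0r /T eZ -scalerBr; apply: lowZ.
  set u := ev _.
  have hu : low (wt s - dg a) (size s)%:Z u.
    by apply: (homog_low (@contr_homog a s v)); lia.
  (* The sign from exchanging [a] and [y] cancels the sign of the contraction. The commutator of [a]
     and [y] is a single generator of degree at most 0 replacing two letters, so the length
     drops. *)
  rewrite e_comm !scalerDr scalerA -signr_addb addbb scale1r.
  rewrite addrAC [_ - e y.1 _ _]addrAC subrr add0r.
  have ha := dg_ge0 a; have hy := dg_ge0 y.
  apply: lowD; apply: lowZ.
    by apply: lowZ; apply: low_neg hu => /=; lia.
  (* Weights are nonnegative, so a central term can arise only from two letters of weight 0. *)
  have [h|/zet0 hz] := eqVneq (- dg a - dg y) 0; last first.
    by rewrite hz scale0r; exact: low0.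
  by apply: lowZ; apply: low_le hu => /=; lia.
have e_sum (F : letter -> M) : e y.1 (- dg y) (\sum_(a <- A) F a)
    = \sum_(a <- A) e y.1 (- dg y) (F a).
  by apply: (big_morph _ (eD _ _)); exact: e0.
have := low_sum A (P := xpredT) (fun a _ => step a); rewrite sumrB big_split /= -e_sum.
have -> : \sum_(a <- A) (if y == a then word (y :: s) v else 0) = word (y :: s) v.
  rewrite (bigD1_seq y) //= eqxx big1 ?addr0 // => a /negbTE.
  by rewrite eq_sym => ->.
move=> h1; have h2 : low (dg y + wt s) (size s).+1%:Z
    (e y.1 (- dg y) (\sum_(a <- A) T a - (size s)%:R *: word s v)).
  by apply: low_cons IH; lia.
have := lowD h1 h2; rewrite -[- (_ *: word s v)]scaleNr eD eZ.
by rewrite opprD !addrA subrK -[_.+1%:R]natr1 scalerDl scale1r opprD scaleNr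
  [- (_ *: _) - _]addrC addrA.
Qed.

Definition contr_family (a : letter) (E : family) : family :=
  flatten [seq contr a p.1 p.2 | p <- E].
Definition map_Lr k (E : family) : family := [seq (p.1, iter k Lr p.2) | p <- E].

Lemma ev_contr_family a E :
  ev (contr_family a E) = \sum_(p <- E) ev (contr a p.1 p.2).
Proof.
elim: E => [|p E IH]; first by rewrite big_nil ev_nil.
by rewrite big_cons -IH -ev_cat.
Qed.

Lemma contr_family_homog a w l E :
  homog w l E -> homog (w - dg a) (l - 1) (contr_family a E).
Proof.
by move=> h s v /flattenP[_ /mapP[[t u] /h[<- <-] ->]] /contr_homog.
Qed.

Lemma contr_map_Lr k a s v : contr a s (iter k Lr v) = map_Lr k (contr a s v).
Proof.
have LrZ x y : iter k Lr (x *: y) = x *: iter k Lr y.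
  elim: k => //= k ->; have Lr0 : Lr 0 = 0.
    by have := Lr_lin (-1) 0 0; rewrite scaler0 addr0 scaleN1r addNr.
  by have := Lr_lin x (iter k Lr y) 0; rewrite !addr0 Lr0 addr0.
elim: s => //= y s IH; rewrite /map_Lr map_cat IH -!map_comp.
congr (_ ++ _); first by case: ifP; rewrite //= LrZ.
by apply: eq_map => p /=; rewrite LrZ.
Qed.

Lemma contr_family_map_Lr k a E :
  contr_family a (map_Lr k E) = map_Lr k (contr_family a E).
Proof.
rewrite /contr_family /map_Lr map_flatten -!map_comp; congr flatten.
by apply: eq_map => p /=; rewrite contr_map_Lr.
Qed.

Lemma euler_family w (l : nat) E : homog w l%:Z E -> exists A : seq letter,
  low w l%:Z (\sum_(a <- A) (kd a)^-1 *: e a.1 (- dg a) (ev (contr_family a E))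
    - l%:R *: ev E).
Proof.
move=> h; exists (undup (flatten (map fst E))).
set A := undup _.
have -> : \sum_(a <- A) (kd a)^-1 *: e a.1 (- dg a) (ev (contr_family a E)) =
  \sum_(p <- E) \sum_(a <- A) (kd a)^-1 *: e a.1 (- dg a) (ev (contr a p.1 p.2)).
  rewrite exchange_big /=; apply: eq_bigr => a _.
  rewrite ev_contr_family -scaler_sumr; congr (_ *: _).
  by apply: (big_morph _ (eD _ _)); exact: e0.
rewrite scaler_sumr -sumrB big_seq; apply: low_sum => -[s v] hs.
have [hw hl] := h _ _ hs.
have := @euler_word A s v (undup_uniq _); rewrite hw; case: hl => ->; apply.
move=> a ha; rewrite mem_undup; apply/flattenP; exists s => //.
by apply/mapP; exists (s, v).
Qed.

Lemma dual_family a w (l : int) k E : homog w l E ->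
  low (w - dg a) (l - 1) (e a.1 (r + dg a) (ev (map_Lr k E))
    - ev (map_Lr k.+1 (contr_family a E))).
Proof.
move=> h; rewrite -contr_family_map_Lr ev_contr_family.
have e_sum (F : seq letter * V -> M) : e a.1 (r + dg a) (\sum_(p <- E) F p)
    = \sum_(p <- E) e a.1 (r + dg a) (F p).
  by apply: (big_morph _ (eD _ _)); exact: e0.
rewrite /ev /map_Lr !big_map e_sum -sumrB big_seq; apply: low_sum => -[s v] hs.
have [<- <-] := h _ _ hs; exact: dual_word.
Qed.

(** * Invariant subsets that meet the image of [V] in zero *)

Variable W : M -> Prop.
Hypothesis W_e : forall b m u, W u -> W (e b m u).
Hypothesis W_iota : forall v, W (iota v) -> v = 0.

(* Applying the dual generators lowers the length while the top terms get hit
   by Lr, which is why the power k of Lr has to be carried along. *)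
Lemma top_vanish (l k : nat) w E u : homog w l%:Z E -> low w l%:Z u ->
  W (ev (map_Lr k E) + u) -> low w l%:Z (ev E).
Proof.
elim: l k w E u => [|l IH] k w E u hE hu hW.
  have ev0 (F : family) : (forall p, p \in F -> p.1 = [::]) ->
      ev F = iota (\sum_(p <- F) p.2).
    move=> hF; rewrite /ev big_seq (eq_bigr (fun p => iota p.2)); last first.
      by move=> p /hF ->.
    rewrite -big_seq; symmetry; apply: (big_morph _ _ iota0).
    by move=> x y; have := iota_lin 1 x y; rewrite !scale1r.
  have nilE p : p \in E -> p.1 = [::].
    by case: p => s v /hE[_ [/size0nil]].
  case: E hE hW nilE ev0 => [|p E] hE hW nilE ev0; first by rewrite ev_nil; exact: low0.
  (* All words of [E] are empty, so [w = 0] and the remainder [u], lying below [(0, 0)], is zero.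
     What is left is the image of one vector of [V], to which [W_iota] and the injectivity of [Lr]
     apply. *)
  have hw : w = 0.
    case: p hE nilE hW => s v hE nilE _.
    by have [<- _] := hE s v (mem_head _ _); have /= -> := nilE _ (mem_head _ _).
  move: hW; rewrite (low00 (u := u)); last by rewrite -{1}hw.
  rewrite addr0 !ev0 //; last by move=> _ /mapP[q /nilE <- ->].
  move=> /W_iota; rewrite big_map /=.
  have -> : \sum_(q <- p :: E) iter k Lr q.2 = iter k Lr (\sum_(q <- p :: E) q.2).
    have Lr0 : Lr 0 = 0.
      by have := Lr_lin (-1) 0 0; rewrite scaler0 addr0 scaleN1r addNr.
    symmetry; apply: big_morph => [x y|].
      elim: k => //= k ->.
      by have := Lr_lin 1 (iter k Lr x) (iter k Lr y); rewrite !scale1r.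
    by elim: k => //= k ->.
  have kinj v : iter k Lr v = 0 -> v = 0 by elim: k => //= k IHk /Lr_inj.
  by move=> /kinj ->; rewrite iota0; exact: low0.
(* The dual of [a] sends the given element of [W] to one whose top part is the contraction with one
   more [Lr] applied; the rest is low, so the induction hypothesis applies. *)
have hc a : low (w - dg a) l%:Z (ev (contr_family a E)).
  have hl : l%:Z = l.+1%:Z - 1 by lia.
  apply: (IH k.+1 _ _ (e a.1 (r + dg a) (ev (map_Lr k E) + u)
    - ev (map_Lr k.+1 (contr_family a E)))).
  - by rewrite hl; exact: contr_family_homog.
  - rewrite eD addrAC; apply: lowD; last by apply: dual_low hu; lia.
    by rewrite hl; exact: dual_family.
  - by rewrite addrC subrK; exact: W_e.
have [A hA] := euler_family hE.
(* By the Euler identity this multiple of [ev E] agrees, modulo low terms, with a combination of the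
   contractions with a letter prefixed, and these are low by [hc]. The factor is invertible in
   characteristic zero. *)
have hS : low w l.+1%:Z (l.+1%:R *: ev E).
  rewrite -[_ *: _]opprK; apply: lowN; rewrite -[- _]add0r.
  have := lowB hA (low_sum A (P := xpredT) (fun a _ => lowZ (kd a)^-1
    (low_cons (a := a) (w' := w) (l' := l.+1%:Z) _ _ (hc a)))).
  rewrite addrAC subrr; apply; lia.
have hl : l.+1%:R != 0 :> K by rewrite pnatr_eq0.
by rewrite -[ev E]scale1r -(mulVf hl) -scalerA; apply: lowZ.
Qed.

Lemma low_top w (l : nat) u : low w l.+1%:Z u -> exists E u',
  [/\ homog w l%:Z E, low w l%:Z u' & u = ev E + u'].
Proof.
elim=> [|x y _ [E [x' [hE hx ->]]] _ [F [y' [hF hy ->]]]|s v h].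
- by exists [::], 0; split => //; [exact: low0|rewrite ev_nil addr0].
- exists (E ++ F), (x' + y'); split; last by rewrite ev_cat addrACA.
    by move=> s v; rewrite mem_cat => /orP[/hE|/hF].
  exact: lowD.
- have [/andP[/eqP hw hs]|h'] := boolP ((wt s == w) && ((size s)%:Z == l%:Z)).
    exists [:: (s, v)], 0; split; [|exact: low0|].
      by move=> t x; rewrite inE => /eqP[-> _]; split=> //; apply/eqP.
    by rewrite /ev big_seq1 addr0.
  exists [::], (word s v); split => //; last by rewrite ev_nil add0r.
  by apply: low_word; lia.
Qed.

(** An element involves finitely many words, so once its weights are below [w] their lengths have a
    common bound. *)
Lemma low_weight w u : low w 0 u -> exists l : nat, low (w - 1) l%:Z u.
Proof.
elim=> [|x y _ [l hx] _ [l' hy]|s v h].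
- by exists 0%N; exact: low0.
- exists (l + l')%N; apply: lowD; [apply: low_le hx|apply: low_le hy]; lia.
- by exists (size s).+1; apply: low_word; lia.
Qed.

(** Lexicographic induction on [(w, l)]: the part of top weight and length is itself low by
    [top_vanish], which lowers [l]; at [l = 0] the weight bound drops by one. *)
Lemma low_vanish (w l : nat) u : low w%:Z l%:Z u -> W u -> u = 0.
Proof.
elim: w l u => [|w IHw] l u; elim: l u => [|l IHl] u hu hW.
- exact: low00.
- have [E [u' [hE hu' eu]]] := low_top hu.
  apply: IHl => //; rewrite eu; apply: (lowD _ hu').
  apply: (top_vanish (k := 0) hE hu'); rewrite /map_Lr /=.
  by rewrite (eq_map (g := id)) ?map_id -?eu // => -[].
- have [l hl] := low_weight hu; by apply: (IHw l) hW; apply: low_le hl; lia.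
- have [E [u' [hE hu' eu]]] := low_top hu.
  apply: IHl => //; rewrite eu; apply: (lowD _ hu').
  apply: (top_vanish (k := 0) hE hu'); rewrite /map_Lr /=.
  by rewrite (eq_map (g := id)) ?map_id -?eu // => -[].
Qed.

Lemma spanned_e b m u : spanned u -> spanned (e b m u).
Proof.
move=> [w [l]]; elim=> [|x y _ hx _ hy|s v _].
- by rewrite e0; exists 0%N, 0%N; exact: low0.
- by rewrite eD; exact: spannedD.
have hs : forall t x, spanned (word t x).
  by move=> t x; exists (absz (wt t)).+1, 0%N; apply: low_word; lia.
rewrite -[e b m _](subrK (if ~~ b && (m == r) then word s (Lr v) else 0)).
apply: spannedD; last by case: ifP => // _; exists 0%N, 0%N; exact: low0.
exists (absz (wt s + r - m)%R).+1, 0%N; apply: low_le (gen_word s v b m); lia.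
Qed.

Lemma spanned_vanish u : spanned u -> W u -> u = 0.
Proof. by move=> [w [l]]; exact: low_vanish. Qed.
End Words.

(** * The embedding of V in the induced module *)

Section RightAction.
Variables (K : numFieldType) (g : lieSuperalgebra K) (X : lmodType K).
(** [f x q] is the right action [q x], so [f y (f x q)] is [q (x y)]. No sign passes [q], as [X]
    carries no grading. *)
Variable f : g -> X -> X.
Hypothesis f_linl : forall (a : K) x y q, f (a *: x + y) q = a *: f x q + f y q.
Hypothesis f_linr : forall (a : K) x q q', f x (a *: q + q') = a *: f x q + f x q'.
Hypothesis f_bracket : forall b c x y q,
  hom (lsa_grading g) b x -> hom (lsa_grading g) c y ->
  f y (f x q) - (-1) ^+ (b && c) *: f x (f y q) = f (bracket x y) q.

Fixpoint uract (t : uterm g) (q : X) : X :=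
  match t with
  | UVar x => f x q
  | UConst a => a *: q
  | UAdd s t => uract s q + uract t q
  | UMul s t => uract t (uract s q)
  end.

Lemma uract_lin t (a : K) q q' : uract t (a *: q + q') = a *: uract t q + uract t q'.
Proof.
elim: t q q' => [x|b|s hs t ht|s hs t ht] q q' /=.
- exact: f_linr.
- by rewrite scalerDr !scalerA mulrC.
- by rewrite hs ht scalerDr addrACA.
- by rewrite hs ht.
Qed.
Lemma uract0 t : uract t 0 = 0.
Proof. by have := uract_lin t (-1) 0 0; rewrite scaler0 addr0 scaleN1r addNr. Qed.
Lemma uractD t q q' : uract t (q + q') = uract t q + uract t q'.
Proof. by have := uract_lin t 1 q q'; rewrite !scale1r. Qed.
Lemma uractZ t a q : uract t (a *: q) = a *: uract t q.
Proof. by rewrite -[a *: q]addr0 uract_lin uract0 addr0. Qed.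

Lemma uract_eq s t : ueq s t -> forall q, uract s q = uract t q.
Proof.
have fZ x (a : K) q : f x (a *: q) = a *: f x q by exact: (uractZ (UVar x)).
elim=> //=.
- by move=> > _ h _ k q; rewrite h k.
- by move=> > _ h _ k q; rewrite h k.
- by move=> > _ h _ k q; rewrite h k.
- by move=> *; rewrite addrA.
- by move=> s' t' q; rewrite addrC.
- by move=> *; rewrite scale0r add0r.
- by move=> *; rewrite uractZ scaleN1r addNr scale0r.
- by move=> *; rewrite scale1r.
- by move=> *; rewrite uractD.
- by move=> *; rewrite scalerDl.
- by move=> *; rewrite scalerA mulrC.
- by move=> *; rewrite uractZ.
- by move=> a x y q; rewrite f_linl fZ.
- by move=> b c x y hx hy q; rewrite -(f_bracket q hx hy) !fZ addrC subrK.
Qed.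

Definition ract (u : envalg g) (q : X) : X := uract (repr u) q.

Lemma ract_pi s q : ract (\pi_(envalg g) s) q = uract s q.
Proof. by apply: uract_eq; exact: ueq_repr. Qed.
Lemma ract_var x q : ract (env_var x) q = f x q.
Proof. exact: ract_pi. Qed.
Lemma ractA (a : K) q : ract (a%:A) q = a *: q.
Proof. by rewrite -pi_UConst ract_pi. Qed.
Lemma ract1 q : ract 1 q = q.
Proof. by rewrite -[1]scale1r ractA scale1r. Qed.
Lemma ractD u v q : ract (u + v) q = ract u q + ract v q.
Proof. by elim/quotW: u => s; elim/quotW: v => t; rewrite -pi_UAdd !ract_pi. Qed.
Lemma ractM u v q : ract (u * v) q = ract v (ract u q).
Proof. by elim/quotW: u => s; elim/quotW: v => t; rewrite -pi_UMul !ract_pi. Qed.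
Lemma ractZ (a : K) u q : ract (a *: u) q = a *: ract u q.
Proof. by rewrite -[u in LHS]mul1r scalerAl ractM ractA; exact: uractZ. Qed.
End RightAction.

(** * The right Ramond module U(B) + G_0 U(B) *)

Section RamondSplitting.
Variable K : numFieldType.
Local Notation g := (ramond K).
Local Notation B := (ramondB K).
Local Notation UB := (envalg B).
Local Notation F := {malg K[ramond_basis]}.
Local Notation elt := (@ramondB_elt K).

(* The right U(B)-module U(B) + G_0 U(B), in which (a, b) stands for a + G_0 b. *)
Definition dbl : lmodType K := (UB * UB)%type.
Definition rmul (w : UB) (q : dbl) : dbl := (q.1 * w, q.2 * w).

Lemma rmul_linl (a : K) u v q : rmul (a *: u + v) q = a *: rmul u q + rmul v q.
Proof. by rewrite /rmul !mulrDr -!scalerAr. Qed.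
Lemma rmul_linr w (a : K) q q' : rmul w (a *: q + q') = a *: rmul w q + rmul w q'.
Proof. by rewrite /rmul /= !mulrDl -!scalerAl. Qed.
Lemma rmulM u v q : rmul (u * v) q = rmul v (rmul u q).
Proof. by rewrite /rmul /= !mulrA. Qed.
Lemma rmulDl u v q : rmul (u + v) q = rmul u q + rmul v q.
Proof. by have := rmul_linl 1 u v q; rewrite !scale1r. Qed.
Lemma rmulDr w q q' : rmul w (q + q') = rmul w q + rmul w q'.
Proof. by have := rmul_linr w 1 q q'; rewrite !scale1r. Qed.
Lemma rmul0 w : rmul w 0 = 0.
Proof. by rewrite /rmul /= !mul0r. Qed.
Lemma rmulZr w a q : rmul w (a *: q) = a *: rmul w q.
Proof. by rewrite -[a *: q]addr0 rmul_linr rmul0 addr0. Qed.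
Lemma rmulZl w a q : rmul (a *: w) q = a *: rmul w q.
Proof. by rewrite /rmul -!scalerAr. Qed.
Lemma rmulA a q : rmul a%:A q = a *: q.
Proof. by rewrite /rmul -!scalerAr !mulr1; case: q. Qed.

Definition state : lmodType K := (ramond_basis -> dbl).

(** The sign [(-1)^(b |x|)] in front of [x], in a form linear in [x] and defined without assuming
    [x] homogeneous. *)
Definition twist (b : bool) (x : B) : B :=
  if b then parity_inv (lsa_grading B) x else x.

Lemma twist_lin b (a : K) x y : twist b (a *: x + y) = a *: twist b x + twist b y.
Proof. by rewrite /twist; case: b => //; exact: parity_inv_lin. Qed.
Lemma twist_hom b c x : hom (lsa_grading B) c x -> twist b x = (-1) ^+ (b && c) *: x.
Proof.
by rewrite /twist; case: b => hx; rewrite ?expr0 ?scale1r // (parity_inv_hom hx).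
Qed.

(* Functions from the basis of the Ramond algebra to dbl, with the right action
   (eta x)(z) = eta [x, z] + (-1)^(|x||z|) (eta z) x of B. *)
Definition state_act (x : B) (eta : state) : state := fun k =>
  lin_ext eta (ramond_bracket (sub_val x) << k >>)
    + rmul (env_var (twist (ramond_odd k) x)) (eta k).

Lemma lin_ext_linf (eta eta' : state) (a : K) (z : F) :
  lin_ext ((a *: eta + eta') : state) z = a *: lin_ext eta z + lin_ext eta' z.
Proof.
rewrite /lin_ext scaler_sumr -big_split /=; apply: eq_bigr => k _.
by rewrite scalerDr !scalerA mulrC.
Qed.

Lemma state_act_linl (a : K) x y eta :
  state_act (a *: x + y) eta = a *: state_act x eta + state_act y eta.
Proof.
apply: funext => k; rewrite /state_act sub_val_lin ramond_linl lin_ext_lin.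
rewrite twist_lin env_var_lin rmul_linl addrACA; congr (_ + _).
by rewrite scalerDr.
Qed.

Lemma state_act_linr (a : K) x eta eta' :
  state_act x (a *: eta + eta') = a *: state_act x eta + state_act x eta'.
Proof.
apply: funext => k; rewrite /state_act lin_ext_linf.
have -> : (a *: eta + eta') k = a *: eta k + eta' k by [].
by rewrite rmul_linr addrACA -scalerDr.
Qed.

Lemma lin_ext_state_act b c x z eta : hom (lsa_grading B) b x -> ramond_hom c z ->
  lin_ext (state_act x eta) z = lin_ext eta (ramond_bracket (sub_val x) z)
    + (-1) ^+ (b && c) *: rmul (env_var x) (lin_ext eta z).
Proof.
move=> hx; elim/ramond_hom_ind => [|a u v hu hv|k <-].
- by rewrite !ramond0r !lin_ext0 rmul0 scaler0 addr0.
- rewrite ramond_linr !lin_ext_lin hu hv rmul_linr !scalerDr !scalerA addrACA.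
  by rewrite mulrC.
- rewrite !lin_extU /state_act (twist_hom _ hx) env_varZ rmulZl andbC.
  by [].
Qed.

Lemma subr_cross (Z : zmodType) (p q x y u v : Z) :
  p + x + (y + u) - (q + y + (x + v)) = p - q + (u - v).
Proof.
rewrite [y + u]addrC addrACA [x + v]addrC [q + y + _]addrACA [y + x]addrC.
by rewrite opprD [LHS]addrACA subrr addr0 opprD addrACA.
Qed.

(** The iterated brackets combine by the super Jacobi identity, the products acting on [eta k] by
    the bracket relation in U(B), and the mixed terms cancel in pairs. *)
Lemma state_act_bracket b c x y eta :
  hom (lsa_grading B) b x -> hom (lsa_grading B) c y ->
  state_act y (state_act x eta) - (-1) ^+ (b && c) *: state_act x (state_act y eta)
    = state_act (bracket x y) eta.
Proof.
move=> hx hy; apply: funext => k.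
have hk := @ramond_homU K k; set d := ramond_odd k in hk.
have E b1 c1 x1 y1 : hom (lsa_grading B) b1 x1 -> hom (lsa_grading B) c1 y1 ->
  state_act y1 (state_act x1 eta) k =
    lin_ext eta (ramond_bracket (sub_val x1) (ramond_bracket (sub_val y1) << k >>))
    + (-1) ^+ (b1 && (c1 (+) d)) *: rmul (env_var x1)
        (lin_ext eta (ramond_bracket (sub_val y1) << k >>))
    + ((-1) ^+ (d && c1) *: rmul (env_var y1)
        (lin_ext eta (ramond_bracket (sub_val x1) << k >>))
    + (-1) ^+ (d && c1) *:
        ((-1) ^+ (d && b1) *: rmul (env_var x1 * env_var y1) (eta k))).
  move=> h1 h2.
  rewrite {1}/state_act (lin_ext_state_act eta h1 (ramond_bracket_hom h2 hk)).
  rewrite (twist_hom _ h2) env_varZ rmulZl /state_act rmulDr scalerDr.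
  by rewrite (twist_hom _ h1) env_varZ rmulZl rmulZr rmulM.
rewrite -[LHS]/(state_act y (state_act x eta) k
  - (-1) ^+ (b && c) *: state_act x (state_act y eta) k).
rewrite (E b c) // (E c b) //.
rewrite /state_act (twist_hom _ (bracket_hom hx hy)) env_varZ rmulZl.
rewrite -(env_var_bracket hx hy).
have -> : ramond_bracket (sub_val (bracket x y)) << k >> =
  ramond_bracket (sub_val x) (ramond_bracket (sub_val y) << k >>)
  - (-1) ^+ (b && c) *: ramond_bracket (sub_val y) (ramond_bracket (sub_val x) << k >>).
  have := ramond_bracket_jacobi hx hy hk => ->.
  by rewrite addrK.
have lin_extB (z z' : F) : lin_ext eta (z - z') = lin_ext eta z - lin_ext eta z'.
  by have := lin_ext_lin eta (-1) z' z; rewrite !scaleN1r addrC => ->; rewrite addrC.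
have rmulB (u v : UB) q : rmul (u - v) q = rmul u q - rmul v q.
  by have := rmul_linl (-1) v u q; rewrite !scaleN1r addrC => ->; rewrite addrC.
rewrite lin_extB lin_extZ rmulB rmulZl -/d !scalerDr !scalerN !scalerA.
have -> : (-1) ^+ (b && c) * (-1) ^+ (c && (b (+) d)) = (-1) ^+ (d && c) :> K.
  by case: (b) (c) (d) => [] [] []; rewrite /= ?expr0 ?expr1; ring.
have -> : (-1) ^+ (b && c) * (-1) ^+ (d && b) = (-1) ^+ (b && (c (+) d)) :> K.
  by case: (b) (c) (d) => [] [] []; rewrite /= ?expr0 ?expr1; ring.
rewrite subr_cross; congr (_ + (_ - _)); congr (_ *: _).
  by case: (b) (c) (d) => [] [] []; rewrite /= ?expr0 ?expr1; ring.
by case: (b) (c) (d) => [] [] []; rewrite /= ?expr0 ?expr1; ring.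
Qed.

Lemma ramondB_ind (P : B -> Prop) :
  (forall (a : K) x y, P x -> P y -> P (a *: x + y)) -> P 0 ->
  (forall k, ramondB_basis k -> P (elt k)) -> forall x, P x.
Proof.
move=> hl h0 hU x; suff [x' e hx'] : exists2 x', sub_val x' = sub_val x & P x'.
  by rewrite -(sub_val_inj e).
have hx : ramondB_mem (sub_val x) by exact: (valP x).
elim/(@ramondB_mem_ind K): hx => [|a u v [u' <- hu] [v' <- hv]|k hk].
- by exists 0; rewrite ?sub_val0.
- by exists (a *: u' + v'); [rewrite sub_val_lin|exact: hl].
- by exists (elt k); [rewrite ramondB_eltE|exact: hU].
Qed.

Lemma dbl_ind (P : dbl -> Prop) :
  (forall (a : K) q q', P q -> P q' -> P (a *: q + q')) -> P (1, 0) -> P (0, 1) ->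
  (forall b x q, hom (lsa_grading B) b x -> P q -> P (rmul (env_var x) q)) ->
  forall q, P q.
Proof.
move=> hl h1 h2 hr q.
have h0 : P 0 by have := hl (-1) _ _ h1 h1; rewrite scaleN1r addNr.
have hD q1 q2 : P q1 -> P q2 -> P (q1 + q2).
  by move=> k1 k2; rewrite -[q1]scale1r; exact: hl.
have hZ (a : K) q1 : P q1 -> P (a *: q1).
  by move=> k1; rewrite -[_ *: _]addr0; exact: hl.
have hM u q1 : P q1 -> P (rmul u q1).
  elim/env_ind: u q1 => [x|a|u v hu hv|u v hu hv] q1 hq.
  - have [x0 [x1 [k0 k1 ->]]] := hom_decomp (lsa_grading B) x.
    have -> : x0 + x1 = 1 *: x0 + x1 by rewrite scale1r.
    by rewrite env_var_lin scale1r rmulDl; apply: hD; [apply: hr k0 _|apply: hr k1 _].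
  - by rewrite rmulA; exact: hZ.
  - by rewrite rmulDl; apply: hD; [exact: hu|exact: hv].
  - by rewrite rmulM; apply/hv/hu.
have -> : q = rmul q.1 (1, 0) + rmul q.2 (0, 1).
  by case: q => u v; rewrite /rmul /= !mul1r !mul0r -[RHS]/(_ + _, _ + _) addr0 add0r.
by apply: hD; apply: hM.
Qed.

(* G_0^2 = - L_0 - C / 24 lies in B. *)
Definition sqG0 : B := - 24^-1 *: elt RC - elt (RL 0).

Lemma sub_val_sqG0 : sub_val sqG0 = - 24^-1 *: << RC >> - << RL 0 >>.
Proof. by rewrite sub_valD sub_valN sub_valZ !ramondB_eltE. Qed.

Definition is_G0 (k : ramond_basis) : bool := if k is RG m then m == 0 else false.

(** The generators of negative degree act by zero on 1 and on [G_0], as in the quotient of U(R) by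
    the right ideal that they generate. Here [(0, 1)] is [G_0], and [sqG0] is its square. *)
Definition state1 : state := fun k =>
  if ramondB_basis k then (env_var (elt k), 0) else if is_G0 k then (0, 1) else 0.
Definition stateG : state := fun k =>
  if ramondB_basis k then (0, env_var (elt k))
  else if is_G0 k then (env_var sqG0, 0) else 0.

Definition state_of (q : dbl) : state :=
  ract state_act q.1 state1 + ract state_act q.2 stateG.

Definition tri (z : F) (q : dbl) : dbl := lin_ext (state_of q) z.

Lemma state_of_lin (a : K) q q' :
  state_of (a *: q + q') = a *: state_of q + state_of q'.
Proof.
rewrite /state_of /= !(ractD state_act_linl state_act_linr state_act_bracket).
rewrite !(ractZ state_act_linl state_act_linr state_act_bracket) scalerDr.
exact: addrACA.
Qed.

Lemma tri_linl (a : K) x y q : tri (a *: x + y) q = a *: tri x q + tri y q.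
Proof. exact: lin_ext_lin. Qed.
Lemma tri_linr (a : K) x q q' : tri x (a *: q + q') = a *: tri x q + tri x q'.
Proof. by rewrite /tri state_of_lin lin_ext_linf. Qed.
Lemma tri0r x : tri x 0 = 0.
Proof. by have := tri_linr (-1) x 0 0; rewrite scaler0 addr0 scaleN1r addNr. Qed.
Lemma tri0l q : tri 0 q = 0.
Proof. exact: lin_ext0. Qed.
Lemma triZl (a : K) x q : tri (a *: x) q = a *: tri x q.
Proof. exact: lin_extZ. Qed.
Lemma triNl x q : tri (- x) q = - tri x q.
Proof. by rewrite -[- x]scaleN1r triZl scaleN1r. Qed.
Lemma triZr (a : K) x q : tri x (a *: q) = a *: tri x q.
Proof. by rewrite -[a *: q]addr0 tri_linr tri0r addr0. Qed.
Lemma triDr x q q' : tri x (q + q') = tri x q + tri x q'.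
Proof. by have := tri_linr 1 x q q'; rewrite !scale1r. Qed.

(** This is [q x z = q [x, z] + (-1)^(|x||z|) q z x]; it is built in, since [state_of] turns right
    multiplication by [x] into [state_act x]. *)
Lemma tri_rmul b c x z q : hom (lsa_grading B) b x -> ramond_hom c z ->
  tri z (rmul (env_var x) q) = tri (ramond_bracket (sub_val x) z) q
    + (-1) ^+ (b && c) *: rmul (env_var x) (tri z q).
Proof.
move=> hx hz; rewrite /tri -(lin_ext_state_act _ hx hz); congr lin_ext.
rewrite /state_of /rmul /= !(ractM state_act_linl state_act_linr state_act_bracket).
rewrite !(ract_var state_act_linl state_act_linr state_act_bracket).
have := state_act_linr 1 x (ract state_act q.1 state1) (ract state_act q.2 stateG).
by rewrite !scale1r.
Qed.

Lemma tri1 k : tri << k >> (1, 0) = state1 k.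
Proof.
rewrite /tri lin_extU /state_of /=.
rewrite (ract1 state_act_linl state_act_linr state_act_bracket).
have -> : (0 : UB) = 0 *: 1 by rewrite scale0r.
by rewrite (ractZ state_act_linl state_act_linr state_act_bracket) scale0r addr0.
Qed.
Lemma triG k : tri << k >> (0, 1) = stateG k.
Proof.
rewrite /tri lin_extU /state_of /=.
rewrite (ract1 state_act_linl state_act_linr state_act_bracket).
have -> : (0 : UB) = 0 *: 1 by rewrite scale0r.
by rewrite (ractZ state_act_linl state_act_linr state_act_bracket) scale0r add0r.
Qed.

(** On [(1, 0)] and [(0, 1)] this is the choice of the initial states. It passes from [q] to [q y]
    by [tri_rmul] and the bracket relation in U(B). *)
Lemma tri_sub (x : B) q : tri (sub_val x) q = rmul (env_var x) q.
Proof.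
elim/dbl_ind: q x => [a q q' hq hq'|||b y q hy hq] x.
- by rewrite tri_linr hq hq' rmul_linr.
- elim/ramondB_ind: x => [a x y hx hy||k hk].
  + by rewrite sub_val_lin tri_linl hx hy env_var_lin rmul_linl.
  + by rewrite sub_val0 tri0l env_var0 /rmul !mulr0.
  + by rewrite ramondB_eltE // tri1 /state1 hk /rmul /= mul1r mul0r.
- elim/ramondB_ind: x => [a x y hx hy||k hk].
  + by rewrite sub_val_lin tri_linl hx hy env_var_lin rmul_linl.
  + by rewrite sub_val0 tri0l env_var0 /rmul !mulr0.
  + by rewrite ramondB_eltE // triG /stateG hk /rmul /= mul1r mul0r.
have main c z : hom (lsa_grading B) c z ->
    tri (sub_val z) (rmul (env_var y) q) = rmul (env_var z) (rmul (env_var y) q).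
  move=> hz; rewrite (tri_rmul q hy hz) hq.
  rewrite -[ramond_bracket _ _]/(sub_val (bracket y z)) hq.
  rewrite -(env_var_bracket hy hz) -!rmulM -rmulZl -rmulDl.
  by rewrite addrC subrKC.
have [x0 [x1 [k0 k1 ->]]] := hom_decomp (lsa_grading B) x.
have -> : x0 + x1 = 1 *: x0 + x1 by rewrite scale1r.
by rewrite sub_val_lin tri_linl env_var_lin rmul_linl (main _ _ k0) (main _ _ k1).
Qed.

(** * The bracket relation for the right action *)

Definition tri_rel (q : dbl) b c (x y : F) : Prop :=
  tri y (tri x q) - (-1) ^+ (b && c) *: tri x (tri y q) = tri (ramond_bracket x y) q.

Lemma tri_rel_sym q b c x y : ramond_hom b x -> ramond_hom c y ->
  tri_rel q b c x y -> tri_rel q c b y x.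
Proof.
rewrite /tri_rel => hx hy h; rewrite (ramond_bracket_skew hy hx) triNl triZl -h.
by rewrite scalerBr scalerA andbC -expr2 sqrr_sign scale1r opprB.
Qed.

Lemma tri_rel_sub q b c x y : ramond_hom b x -> hom (lsa_grading B) c y ->
  tri_rel q b c x (sub_val y).
Proof.
move=> hx hy; rewrite /tri_rel !tri_sub (tri_rmul q hy hx) scalerDr scalerA andbC.
rewrite -expr2 sqrr_sign scale1r opprD addrCA subrr addr0.
by rewrite (ramond_bracket_skew hx hy) triNl triZl andbC.
Qed.

Lemma tri_rel_lift q :
  (forall i j, tri_rel q (ramond_odd i) (ramond_odd j) << i >> << j >>) ->
  forall b c x y, ramond_hom b x -> ramond_hom c y -> tri_rel q b c x y.
Proof.
move=> h b c x y hx hy; elim/ramond_hom_ind: hx => [|a u v hu hv|i <-].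
- by rewrite /tri_rel ramond0l !tri0l tri0r scaler0 subrr.
- rewrite /tri_rel ramond_linl !tri_linl tri_linr -hu -hv scalerDr opprD addrACA.
  by rewrite scalerBr !scalerA mulrC.
elim/ramond_hom_ind: hy => [|a u v hu hv|j <-]; last exact: h.
- by rewrite /tri_rel ramond0r !tri0l tri0r scaler0 subrr.
- rewrite /tri_rel ramond_linr !tri_linl tri_linr -hu -hv scalerDr opprD addrACA.
  by rewrite scalerBr !scalerA mulrC.
Qed.

Definition gen_dbl (b : bool) : dbl := if b then (0, 1) else (1, 0).

Definition is_neg (k : ramond_basis) : bool := ~~ ramondB_basis k && ~~ is_G0 k.

Lemma tri_neg k b : is_neg k -> tri << k >> (gen_dbl b) = 0.
Proof.
case/andP=> /negbTE hB /negbTE hG.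
by case: b; rewrite ?tri1 ?triG /state1 /stateG hB hG.
Qed.

Lemma triG0_1 : tri << RG 0 >> (1, 0) = (0, 1).
Proof. by rewrite tri1. Qed.
Lemma triG0_G : tri << RG 0 >> (0, 1) = rmul (env_var sqG0) (1, 0).
Proof. by rewrite triG /stateG /= /rmul /= mul1r mul0r. Qed.

Lemma hom_sqG0 : hom (lsa_grading B) false sqG0.
Proof.
rewrite /= /sub_hom sub_val_sqG0 -scaleN1r.
by apply: ramond_homD; apply: ramond_homZ; apply: ramond_homUe.
Qed.

(** [L_0] acts diagonally on the basis, and no central term appears in nonzero degree. *)
Lemma sqG0_neg k : is_neg k ->
  exists a : K, ramond_bracket (sub_val sqG0) << k >> = a *: << k >>.
Proof.
rewrite sub_val_sqG0 -[- << RL 0 >>]scaleN1r ramondDl !ramondZl !ramondU /=.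
case: k => [m|m|] //= hk; rewrite scaler0 !add0r.
  have /negbTE -> : m != 0 by move: hk; rewrite /is_neg /=; lia.
  by rewrite mul0r scale0r addr0 scalerA; eexists.
by rewrite scalerA; eexists.
Qed.

Lemma tri_neg_G0 k b : is_neg k -> tri << k >> (tri << RG 0 >> (gen_dbl b)) = 0.
Proof.
move=> hk; case: b; rewrite /gen_dbl ?triG0_1 ?triG0_G; last exact: (tri_neg true hk).
rewrite (tri_rmul _ hom_sqG0 (@ramond_homU K k)).
have [a ->] := sqG0_neg hk.
by rewrite triZl (tri_neg false hk) rmul0 !scaler0 addr0.
Qed.

Lemma tri_G0_G0 b : tri << RG 0 >> (tri << RG 0 >> (gen_dbl b))
  = rmul (env_var sqG0) (gen_dbl b).
Proof.
case: b; rewrite /gen_dbl; last by rewrite triG0_1 triG0_G.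
have e0 : ramond_bracket (sub_val sqG0) << RG 0 >> = 0.
  rewrite sub_val_sqG0 -[- << RL 0 >>]scaleN1r ramondDl !ramondZl !ramondU /=.
  by rewrite mul0r subrr scale0r !scaler0 addr0.
rewrite triG0_G (tri_rmul _ hom_sqG0 (@ramond_homU K _)) triG0_1 e0 tri0l.
by rewrite add0r /= expr0 scale1r.
Qed.

(** If [i] or [j] lies in B, this is [tri_rel_sub] up to symmetry. Two negative elements, or a
    negative one and [G_0], have a negative bracket, and all terms vanish. There remains the square
    of [G_0]. *)
Lemma tri_rel_gen b i j :
  tri_rel (gen_dbl b) (ramond_odd i) (ramond_odd j) << i >> << j >>.
Proof.
have hsub (i1 j1 : ramond_basis) : ramondB_basis j1 ->
    tri_rel (gen_dbl b) (ramond_odd i1) (ramond_odd j1) << i1 >> << j1 >>.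
  move=> hj; rewrite -(ramondB_eltE K hj); apply: tri_rel_sub; first exact: ramond_homU.
  by rewrite /= /sub_hom ramondB_eltE //; exact: ramond_homU.
have [hj|hj] := boolP (ramondB_basis j); first exact: hsub.
have [hi|hi] := boolP (ramondB_basis i).
  by apply: tri_rel_sym; [exact: ramond_homU|exact: ramond_homU|exact: hsub].
have neg_neg i1 j1 : is_neg i1 -> is_neg j1 ->
    tri (ramond_br K i1 j1) (gen_dbl b) = 0 ->
    tri_rel (gen_dbl b) (ramond_odd i1) (ramond_odd j1) << i1 >> << j1 >>.
  by move=> h1 h2 h; rewrite /tri_rel ramondU h !tri_neg // !tri0r scaler0 subrr.
have neg_G0 i1 : is_neg i1 -> tri (ramond_br K i1 (RG 0)) (gen_dbl b) = 0 ->
    tri_rel (gen_dbl b) (ramond_odd i1) true << i1 >> << RG 0 >>.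
  move=> h1 h; rewrite /tri_rel ramondU h (tri_neg _ h1) (tri_neg_G0 _ h1).
  by rewrite tri0r scaler0 subrr.
have trU (k : ramond_basis) (a : K) : is_neg k -> tri (a *: << k >>) (gen_dbl b) = 0.
  by move=> hk; rewrite triZl tri_neg // scaler0.
have nC (m n : int) (a : K) : m < 0 -> n <= 0 -> (m + n == 0)%:R * a = 0.
  by move=> hm hn; rewrite (_ : _ == _ = false) ?mul0r //; lia.
have G0_neg m : m < 0 -> tri_rel (gen_dbl b) true true << RG m >> << RG 0 >>.
  move=> hm; apply: (neg_G0 (RG m)); first by rewrite /is_neg /=; lia.
  by rewrite /= nC // scale0r addr0; apply: trU; rewrite /is_neg /=; lia.
case: i j hi hj => [m|m|] [n|n|] //= hi hj.
- apply: (neg_neg (RL m) (RL n)); rewrite /is_neg /= ?hi ?hj //.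
  rewrite nC; [|lia|lia]; rewrite scale0r addr0; apply: trU.
  by rewrite /is_neg /=; lia.
- have [->|hn] := eqVneq n 0.
    apply: (neg_G0 (RL m)); first by rewrite /is_neg /= hi.
    by apply: trU; rewrite /is_neg /=; lia.
  apply: (neg_neg (RL m) (RG n)); rewrite /is_neg /= ?hi ?hj //.
  by apply: trU; rewrite /is_neg /=; lia.
- apply: tri_rel_sym; [exact: ramond_homUe|exact: ramond_homUe|].
  have [->|hn] := eqVneq m 0.
    apply: (neg_G0 (RL n)); first by rewrite /is_neg /= hj.
    by apply: trU; rewrite /is_neg /=; lia.
  apply: (neg_neg (RL n) (RG m)); rewrite /is_neg /= ?hi ?hj //.
  by apply: trU; rewrite /is_neg /=; lia.
- have [hm|hm] := eqVneq m 0; have [hn|hn] := eqVneq n 0; subst.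
  + rewrite /tri_rel tri_G0_G0 ramondU expr1 scaleN1r opprK.
    (* The bracket of [G_0] with itself is twice its square. *)
    have -> : ramond_br K (RG 0) (RG 0) = 2%:R *: sub_val sqG0.
      rewrite sub_val_sqG0 /= mul1r addrC scalerBr scalerA scaleNr.
      by congr (_ *: _ - _); field.
    by rewrite triZl tri_sub scaler_nat mulr2n.
  + apply: tri_rel_sym; [exact: ramond_homUe|exact: ramond_homUe|].
    by apply: G0_neg; lia.
  + by apply: G0_neg; lia.
  + apply: (neg_neg (RG m) (RG n)); rewrite /is_neg /= ?hi ?hj //.
    rewrite nC; [|lia|lia]; rewrite scale0r addr0; apply: trU.
    by rewrite /is_neg /=; lia.
Qed.

Lemma subr_regroup (Z : zmodType) (p r u t a v : Z) :
  p + (r + u) - (t + (a + v)) = p - a + (r - t) + (u - v).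
Proof.
by rewrite [t + _]addrCA opprD [LHS]addrACA opprD [r + u + _]addrACA addrA.
Qed.

(** Passing from [q] to [q l] with [l] in B, [tri_rmul] moves [l] to the right. The super Jacobi
    identity reduces the relation to those for [q] at the pairs [([l, x], y)], [(x, [l, y])] and
    [(x, y)]. *)
Lemma tri_relP q b c x y : ramond_hom b x -> ramond_hom c y -> tri_rel q b c x y.
Proof.
elim/dbl_ind: q b c x y => [a q q' hq hq'|||d l q hl hq] b c x y hx hy.
- rewrite /tri_rel !tri_linr -(hq _ _ _ _ hx hy) -(hq' _ _ _ _ hx hy).
  by rewrite !(scalerBr, scalerDr) !scalerA mulrC opprD addrACA.
- exact: (tri_rel_lift (@tri_rel_gen false)).
- exact: (tri_rel_lift (@tri_rel_gen true)).
have hlx := ramond_bracket_hom hl hx; have hly := ramond_bracket_hom hl hy.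
have h1 := hq _ _ _ _ hlx hy; have h2 := hq _ _ _ _ hx hly.
have h3 := hq _ _ _ _ hx hy.
have h4 : tri (ramond_bracket (sub_val l) (ramond_bracket x y)) q =
    tri (ramond_bracket (ramond_bracket (sub_val l) x) y) q
    + (-1) ^+ (d && b) *: tri (ramond_bracket x (ramond_bracket (sub_val l) y)) q.
  by rewrite (ramond_bracket_jacobi hl hx hy) addrC tri_linl addrC.
rewrite /tri_rel in h1 h2 h3 *.
rewrite !(tri_rmul _ hl hx, tri_rmul _ hl hy) !triDr !triZr.
rewrite !(tri_rmul _ hl hx, tri_rmul _ hl hy).
rewrite (tri_rmul _ hl (ramond_bracket_hom hx hy)) h4 -h1 -h2 -h3.
have rmulBr (u : UB) q1 q2 : rmul u (q1 - q2) = rmul u q1 - rmul u q2.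
  by rewrite addrC -scaleN1r rmul_linr scaleN1r addrC.
rewrite rmulBr rmulZr !(scalerDr, scalerN) !scalerA.
have -> : (-1) ^+ (b && c) * ((-1) ^+ (d && c)) = (-1) ^+ ((d (+) b) && c) :> K.
  by case: (b) (c) (d) => [] [] []; rewrite /= ?expr0 ?expr1; ring.
rewrite subr_regroup; congr (_ + (_ - _ *: _) + (_ *: _ - _ *: _)).
all: by case: (b) (c) (d) => [] [] []; rewrite /= ?expr0 ?expr1; ring.
Qed.

Lemma tri_bracket b c (x y : g) q :
  hom (lsa_grading g) b x -> hom (lsa_grading g) c y ->
  tri y (tri x q) - (-1) ^+ (b && c) *: tri x (tri y q) = tri (bracket x y) q.
Proof. by move=> hx hy; exact: tri_relP. Qed.

Local Notation tact := (ract (g := g) tri).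
Let tactM := @ractM K g dbl tri tri_linl tri_linr tri_bracket.
Let tactD := @ractD K g dbl tri tri_linl tri_linr tri_bracket.
Let tactA := @ractA K g dbl tri tri_linl tri_linr tri_bracket.
Let tact1 := @ract1 K g dbl tri tri_linl tri_linr tri_bracket.
Let tact_var := @ract_var K g dbl tri tri_linl tri_linr tri_bracket.

Lemma tact_incl u w q : tact (u * env_incl w) q = rmul w (tact u q).
Proof.
elim/env_ind: w u => [x|a|w w' hw hw'|w w' hw hw'] u.
- rewrite env_incl_var tactM.
  by rewrite tact_var tri_sub.
- rewrite env_inclA tactM.
  by rewrite tactA rmulA.
- by rewrite rmorphD mulrDr tactD hw hw' rmulDl.
- by rewrite rmorphM mulrA hw' hw rmulM.
Qed.

Variable V : superModule B.

(** The first component of [1 u] is right U(B)-linear in [u] and equals 1 at [u = 1]. Letting it act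
    on [w] thus defines a map on the tensor product that sends [1 (x) v] back to [v]. *)
Lemma ind_tens1_inj (v : V) : ind_tens 1 v = 0 -> v = 0.
Proof.
pose f (u : envalg g) (w : env_mod V) : env_mod V := (tact u (1, 0)).1 *: w.
have fDl b b' n : f (b + b') n = f b n + f b' n.
  by rewrite /f tactD scalerDl.
have fDr b n n' : f b (n + n') = f b n + f b n' by exact: scalerDr.
have f_bal b a n : f (b * env_incl a) n = f b (a *: n).
  by rewrite /f tact_incl scalerA.
move=> e; have := ext_lift_tens fDl fDr f_bal 1 v.
rewrite -[tens _ _ _]/(ind_tens 1 v) e (ext_lift0 fDl fDr f_bal) => {e}e.
by rewrite -[v]/(v : env_mod V) e /f tact1 scale1r.
Qed.
End RamondSplitting.

(** * Simplicity of the induced module *)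

Section InducedModule.
Variables (K : numFieldType) (c : K) (V : superModule (ramondB K)).
Local Notation g := (ramond K).
Local Notation B := (ramondB K).
Local Notation elt := (@ramondB_elt K).
Hypothesis C_act : forall v : V, act (elt RC) v = c *: v.

Local Notation M := (induced V).

Definition iota (v : V) : M := ind_tens 1 v.

Lemma iota_lin (a : K) u v : iota (a *: u + v) = a *: iota u + iota v.
Proof. by rewrite /iota ind_tensDr ind_tensZr ind_tensZ. Qed.

Lemma iotaZ (a : K) v : iota (a *: v) = a *: iota v.
Proof. by rewrite /iota ind_tensZr ind_tensZ. Qed.

Lemma act_iota (x : B) v : act (sub_val x : g) (iota v) = iota (act x v).
Proof.
rewrite /iota /= /ind_act ind_actE mulr1 -[env_var _]mul1r -env_incl_var ind_tens_bal.
by congr ind_tens; exact: (@env_act_var K B V x v).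
Qed.

Lemma act_iota_basis k v : ramondB_basis k ->
  act (<< k >> : g) (iota v) = iota (act (elt k) v).
Proof. by move=> hk; rewrite -act_iota ramondB_eltE. Qed.

Lemma env_RC_comm u : env_var (<< RC >> : g) * u = u * env_var (<< RC >> : g).
Proof.
elim/env_ind: u => [x|a|u v hu hv|u v hu hv].
- have C0 b y : hom (lsa_grading g) b y ->
      env_var (<< RC >> : g) * env_var y = env_var y * env_var (<< RC >> : g).
    move=> hy; have := @env_var_bracket K g false b _ _ (@ramond_homU K RC) hy.
    have -> : bracket (<< RC >> : g) y = 0.
      elim/ramond_hom_ind: hy => [|a u v hu hv|k _]; first exact: ramond0r.
        rewrite /= ramond_linr -![ramond_bracket _ _]/(bracket (_ : g) _).
        by rewrite hu hv scaler0 addr0.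
      by rewrite /= ramondU.
    by rewrite env_var0 /= expr0 scale1r => /eqP; rewrite subr_eq0 => /eqP.
  have [x0 [x1 [h0 h1 ->]]] := hom_decomp (lsa_grading g) x.
  have -> : x0 + x1 = 1 *: x0 + x1 by rewrite scale1r.
  by rewrite env_var_lin scale1r mulrDr mulrDl (C0 _ _ h0) (C0 _ _ h1).
- by rewrite -scalerAl -scalerAr mul1r mulr1.
- by rewrite mulrDr mulrDl hu hv.
- by rewrite mulrA hu -mulrA hv mulrA.
Qed.

Lemma act_RC (t : M) : act (<< RC >> : g) t = c *: t.
Proof.
elim/(@ind_ind K g B V): t => [|t t' ht ht'|u v].
- by rewrite scaler0 act0r.
- by rewrite actDr ht ht' -scalerDr.
have -> : ind_tens u v = env_ind_act u (iota v) by rewrite ind_actE mulr1.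
rewrite /= /ind_act env_ind_actA env_RC_comm -env_ind_actA.
rewrite -[env_ind_act _ (iota v)]/(act (<< RC >> : g) (iota v)).
by rewrite act_iota_basis // C_act iotaZ env_ind_actZr.
Qed.

(** * The Ramond generators on the induced module *)

Definition gen (b : bool) (m : int) : ramond_basis := if b then RG m else RL m.
Definition op (b : bool) (m : int) (t : M) : M := act (<< gen b m >> : g) t.

Definition kap (b : bool) (m : int) (b' : bool) (n : int) : K :=
  match b, b' with
  | false, false => (n - m)%:~R
  | false, true => n%:~R - m%:~R / 2
  | true, false => - (m%:~R - n%:~R / 2)
  | true, true => - 2
  end.
Definition zet (b : bool) (m : int) (b' : bool) (n : int) : K :=
  match b, b' with
  | false, false => (m + n == 0)%:R * ((m ^+ 3 - m)%:~R / 12) * c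
  | true, true => (m + n == 0)%:R * ((4 * m ^+ 2 - 1)%:~R / 12) * c
  | _, _ => 0
  end.

Lemma op_comm b m b' n u : op b m (op b' n u) =
  (-1) ^+ (b && b') *: op b' n (op b m u)
    + kap b m b' n *: op (b (+) b') (m + n) u + zet b m b' n *: u.
Proof.
have homg d k : hom (lsa_grading g) d (<< gen d k >> : g).
  by case: d; exact: ramond_homUe.
have := @act_bracket K g M b b' _ _ u (homg b m) (homg b' n).
move=> /eqP; rewrite subr_eq addrC -addrA => /eqP; rewrite /op => ->; congr (_ + _).
rewrite [bracket _ _]ramondU.
have actZl (a : K) (x : g) (t : M) : act (a *: x) t = a *: act x t.
  by rewrite -[a *: x]addr0 act_linl -[0 : g](subrr x) actDl actNl subrr addr0.
case: b b' {homg} => [] [] /=; rewrite ?[n + m]addrC ?scale0r ?addr0.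
- rewrite -[ind_act _ _]/(act (_ : g) (u : M)) actDl !actZl act_RC scalerA.
  by [].
- exact: actZl.
- exact: actZl.
- rewrite -[ind_act _ _]/(act (_ : g) (u : M)) actDl !actZl act_RC scalerA.
  by [].
Qed.

Lemma zet0 b (m : int) b' (n : int) : m + n != 0 -> zet b m b' n = 0.
Proof. by move=> /negbTE h; case: b b' => [] []; rewrite /= ?h ?mul0r. Qed.

Variable r : int.
Hypothesis r_gt0 : 0 < r.
Hypothesis Lr_inj : injective (fun v : V => act (elt (RL r)) v).
Hypothesis L_kill : forall m, r < m -> forall v : V, act (elt (RL m)) v = 0.
Hypothesis Gr_kill : forall v : V, act (elt (RG r)) v = 0.

(** The constant is [-2] for an odd letter and [- (r + 2 dg a)] for an even one. *)
Lemma kap_dual (a : letter) : kap a.1 (r + dg a) a.1 (- dg a) != 0.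
Proof.
case: a => [[] n] /=; first by rewrite oppr_eq0 pnatr_eq0.
by rewrite intr_eq0; rewrite /dg /=; lia.
Qed.

(** Induction from [G_r] with [[L_1, G_m] = (m - 1/2) G_(m+1)]: the coefficient is half an odd
    integer, hence nonzero. *)
Lemma G_kill m : r <= m -> forall v : V, act (elt (RG m)) v = 0.
Proof.
move=> hm v; have [n ->] : exists n : nat, m = r + n%:Z by exists (absz (m - r)); lia.
elim: n v => [|n IH] v; first by rewrite addr0.
have h1 : sub_hom (S := B) false (elt (RL 1)).
  by rewrite /sub_hom ramondB_eltE //; exact: ramond_homUe.
have hB (k : int) : r <= k -> ramondB_basis (RG k) by rewrite /=; lia.
have h2 : sub_hom (S := B) true (elt (RG (r + n%:Z))).
  by rewrite /sub_hom ramondB_eltE; [exact: ramond_homUe|apply: hB; lia].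
have := @act_bracket K B V false true _ _ v h1 h2; rewrite !IH act0r scaler0 subrr.
have -> : bracket (elt (RL 1) : B) (elt (RG (r + n%:Z))) =
    ((r + n%:Z)%:~R - 1 / 2 : K) *: elt (RG (r + n.+1%:Z)).
  apply: sub_val_inj; rewrite [LHS]/= sub_valZ !ramondB_eltE ?hB //; try lia.
  rewrite ramondU /=; congr (_ *: << RG _ >>); lia.
rewrite -[_ *: elt _]addr0 act_linl.
have -> : act (0 : B) v = 0 by rewrite -[0 : B](subrr 0) actDl actNl subrr.
rewrite addr0 => /esym/eqP; rewrite scaler_eq0 => /orP[|/eqP //].
have -> : (r + n)%:~R - 1 / 2 = (2 * (r + n%:Z) - 1)%:~R / 2 :> K by field.
by rewrite mulf_eq0 invr_eq0 pnatr_eq0 orbF intr_eq0; lia.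
Qed.

Local Notation Lr := (fun v : V => act (elt (RL r)) v).

Lemma op_top v : op false r (iota v) = iota (Lr v).
Proof. by rewrite /op act_iota_basis //=; lia. Qed.

Lemma op_kill b (d : int) v : r <= d -> b || (d != r) -> op b d (iota v) = 0.
Proof.
have iota0 : iota 0 = 0 by rewrite -[0 : V](scale0r 0) iotaZ scale0r.
case: b => /= hd hb; rewrite /op act_iota_basis /=; try lia.
  by rewrite G_kill.
by rewrite L_kill //; lia.
Qed.

Lemma op_absorb (b : bool) (d : int) v : b%:Z <= d ->
  exists v', op b d (iota v) = iota v'.
Proof.
by case: b => h; rewrite /op act_iota_basis //; eexists.
Qed.

Lemma op_lin b m (a : K) u v : op b m (a *: u + v) = a *: op b m u + op b m v.
Proof. exact: act_linr. Qed.

(** The span of the words contains the image of [V], which generates [M], and is stable under all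
    generators and under [C]. *)
Lemma spannedM (t : M) : spanned op iota t.
Proof.
have sD := @spannedD _ _ _ op iota; have sZ := spannedZ op_lin iota_lin.
have sact x t' : spanned op iota t' -> spanned op iota (act (x : g) t').
  move=> ht.
  have hb b y : ramond_hom b y -> spanned op iota (act (y : g) t').
    elim/ramond_hom_ind => [|a u v hu hv|k _].
    - by rewrite -[0 : g](subrr 0) actDl actNl subrr -(scale0r t'); exact: sZ.
    - by rewrite act_linl; apply: sD => //; exact: sZ.
    - have sop d m : spanned op iota (op d m t').
        exact: (spanned_e op_lin op_comm zet0 iota_lin r_gt0 op_top op_kill op_absorb).
      case: k => [m|m|]; [exact: (sop false m)|exact: (sop true m)|].
      by rewrite act_RC; exact: sZ.
  have [x0 [x1 [/hb h0 /hb h1 ->]]] := hom_decomp (lsa_grading g) x.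
  by rewrite actDl; exact: sD.
have senv u t' : spanned op iota t' -> spanned op iota (env_ind_act u t' : M).
  elim/env_ind: u t' => [x|a|u v hu hv|u v hu hv] t' ht.
  - exact: sact.
  - by rewrite -ind_scaleE; exact: sZ.
  - by rewrite env_ind_actDl; apply: sD; [exact: hu|exact: hv].
  - by rewrite -env_ind_actA; apply/hu/hv.
elim/(@ind_ind K g B V): t => [|t t' ht ht'|u v].
- by exists 0%N, 0%N; exact: low0.
- exact: sD.
have -> : ind_tens u v = env_ind_act u (iota v) by rewrite ind_actE mulr1.
by apply: senv; exact: spanned_iota.
Qed.

(** * Submodules of the induced module *)

Lemma submodule_vanish (W : M -> Prop) : graded_submodule W ->
  (forall v, W (iota v) -> v = 0) -> forall t, W t -> t = 0.
Proof.
move=> gW Wiota t.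
have Lr_lin (a : K) u v : Lr (a *: u + v) = a *: Lr u + Lr v by exact: act_linr.
have Lr_inj0 v : Lr v = 0 -> v = 0 by move=> h; apply: Lr_inj; rewrite h act0r.
have W_op b m u : W u -> W (op b m u) by exact: (gsub_act gW).
exact: (spanned_vanish op_lin op_comm zet0 iota_lin kap_dual Lr_lin Lr_inj0
  r_gt0 op_top op_kill op_absorb W_op Wiota (spannedM t)).
Qed.

(** The preimage of a submodule [W] in [V] is a graded submodule, so it is zero or all of [V]. In
    the first case [W] vanishes by the cancellation argument; in the second [W] contains generators
    of [M]. *)
Lemma induced_simple : simple_module V -> simple_module M.
Proof.
case=> [[x [v hxv]] sV]; split.
  exists (sub_val x : g), (iota v); rewrite act_iota => /ind_tens1_inj; exact: hxv.
move=> W gW; case: (sV (fun v => W (iota v))) => [|h|h].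
- split.
  + by rewrite -[0 : V](scale0r 0) iotaZ scale0r; exact: (gsub0 gW).
  + by move=> a u w hu hw; rewrite iota_lin; exact: (gsub_lin gW).
  + by move=> y u hu; rewrite -act_iota; exact: (gsub_act gW).
  (* [iota] preserves parity, so by uniqueness the homogeneous components of [iota u] in [W] are the
     images of those of [u]. *)
  + move=> u hu; have [u0 [u1 [h0 h1 eu]]] := hom_decomp (smod_grading V) u.
    have [w0 [w1 [[k0 k1] g0 g1 ew]]] := gsub_graded gW hu.
    have i0 : hom (smod_grading M) false (iota u0).
      apply: (@ind_homT K g B V false false) h0.
      by rewrite -[1]scale1r; exact: env_homA.
    have i1 : hom (smod_grading M) true (iota u1).
      apply: (@ind_homT K g B V false true) h1.
      by rewrite -[1]scale1r; exact: env_homA.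
    have euD : iota u0 + iota u1 = w0 + w1.
      by rewrite -ew eu -[u0 in RHS]scale1r iota_lin scale1r.
    have [a0 a1] := hom_uniq i0 i1 g0 g1 euD.
    by exists u0, u1; rewrite a0 a1.
- by left; exact: submodule_vanish.
- right => t; elim/(@ind_ind K g B V): t => [|t t' ht ht'|u w].
  + exact: (gsub0 gW).
  + by rewrite -[t]scale1r; exact: (gsub_lin gW).
  have -> : ind_tens u w = env_ind_act u (iota w) by rewrite ind_actE mulr1.
  have hw := h w; elim/env_ind: u (iota w) hw => [x1|a|u v1 hu hv|u v1 hu hv] t ht.
  + exact: (gsub_act gW x1).
  + rewrite -ind_scaleE -[a *: _]addr0; apply: (gsub_lin gW) => //; exact: (gsub0 gW).
  + rewrite env_ind_actDl -[env_ind_act u t]scale1r; apply: (gsub_lin gW) => //.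
      exact: hu.
    exact: hv.
  + by rewrite -env_ind_actA; apply/hu/hv.
Qed.
End InducedModule.

Theorem theorem3p4 (R : realType) (c : R[i])
    (V : superModule (ramondB R[i])) :
  simple_module V ->
  (forall v : V, act (ramondB_elt R[i] RC) v = c *: v) ->
  (exists r : int,
    [/\ 2 <= r,
        injective (fun v : V => act (ramondB_elt R[i] (RL r)) v),
        forall m : int, r < m ->
          forall v : V, act (ramondB_elt R[i] (RL m)) v = 0 &
        forall v : V, act (ramondB_elt R[i] (RG r)) v = 0]) ->
  simple_module (induced V).
Proof.
move=> sV hC [r [hr Lr_inj L_kill Gr_kill]].
by apply: (induced_simple hC _ Lr_inj L_kill Gr_kill sV); apply: lt_le_trans hr.
Qed.
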